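(* Let $(B,\leq)$ be a stationary ordered, properly ordered, simple Bratteli diagram with no multiple edges between levels $0$ and $1$, and let $\sigma$ be the substitution read on $(B,\leq)$; assume that $\sigma$ is primitive and that $X_\sigma$ is a Cantor set. Then there exist countably infinitely many telescopings $B_n$ ($n\ge 1$) of $B$, equipped with proper orders $\leq_n$, and corresponding substitutions $\zeta_n$ read on $(B_n,\leq_n)$, such that the substitution dynamical systems $(X_{\zeta_n},T_{\zeta_n})$, $n\ge 1$, are pairwise non-isomorphic and each of them is strong orbit equivalent to $(X_\sigma,T_\sigma)$.
   Context: **Bratteli diagrams.** A Bratteli diagram $B=(V,E)$ is an infinite graph with $V=\bigsqcup_{i\ge 0}V_i$, $E=\bigsqcup_{i\ge1}E_i$, where $V_0=\{v_0\}$, all $V_i,E_i$ are finite, and there are range and source maps $r,s:E\to V$ with $r(E_i)=V_i$, $s(E_i)=V_{i-1}$, $s^{-1}(v)\neq\emptyset$ for all $v\in V$ and $r^{-1}(v)\ne\emptyset$ for all $v\in V\setminus V_0$. The set $V_i$ is the $i$-th level. $X_B$ is the set of infinite paths $(e_i)_{i\ge1}$, $e_i\in E_i$, $r(e_i)=s(e_{i+1})$, with its standard topology. For $n\ge 1$ the incidence matrix $F_n=(f^{(n)}_{vw})$, $v\in V_{n+1}$, $w\in V_n$, is given by $f^{(n)}_{vw}=|\{e\in E_{n+1}: r(e)=v,\ s(e)=w\}|$. $B$ is stationary if (after identifying the levels $V_n$, $n\ge1$) $F_n=F_1$ for all $n\ge2$. $B$ is simple if for every $n>0$ there is $m>n$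 such that any $v\in V_n$, $w\in V_m$ are connected by a finite path. The telescoping of $B$ to a sequence $0=m_0<m_1<\cdots$ is the diagram $B'=(V',E')$ with $V'_n=V_{m_n}$ and $E'_n$ the set of all paths from $V_{m_{n-1}}$ to $V_{m_n}$. An order on $B$ is a linear order on each set $r^{-1}(v)$, $v\in\bigcup_{n\ge1}V_n$. A path is maximal (minimal) if each of its edges $e_i$ is maximal (minimal) in $r^{-1}(r(e_i))$. An order on a simple diagram is proper (and the diagram is properly ordered) if there are a unique maximal and a unique minimal infinite path. An ordered diagram is stationary ordered if it is stationary and the order on $E_n$ does not depend on $n$ (for $n\ge 2$). The orders $\leq_n$ on $B_n$ need not be the ones induced from $(B,\leq)$. **Substitution read on a diagram.** Let $(B,\leq)$ be stationary ordered with no multiple edges between levels $0$ and $1$. Label $V_n=\{v_n(a):a\in\mathcal A\}$, $n>0$, by a finite alphabet $\mathcal A$ in a stationary way. For $a\in\mathcal A$ and $n\ge2$ let $(e_1,\dots,e_t)$ be the ordered list of edges with range $v_n(a)$ and $(a_1,\dots,a_t)$ the labels of their sources; the map $a\mapsto a_1\cdots a_t$ (independent of $n$) is the substitution read on $(B,\leq)$. **Substitution systems.** A substitution on a finite alphabet $\mathcal A$ is a map $\sigma:\mathcal A\to\mathcal A^*$, where $\mathcal A^*$ is the set of finite non-empty words; it extends to words by concatenation. It is primitive if there is $n$ such that for all $a,b\in\mathcal A$ the letter $b$ appears in $\sigma^n(a)$. The language $L_\sigma$ is the set of all finite words occurring in $\sigma^n(a)$, $n\ge0$, $a\in\mathcal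 A$; $X_\sigma$ is the set of $x\in\mathcal A^{\mathbb Z}$ all of whose finite subwords lie in $L_\sigma$, and $T_\sigma$ is the restriction of the left shift to $X_\sigma$. Throughout, all substitutions considered (including the $\zeta_n$) are primitive with $X_\sigma$ a Cantor set; then $(X_\sigma,T_\sigma)$ is a minimal Cantor system. **Equivalences.** Let $(X,T)$, $(Y,S)$ be minimal Cantor systems (a homeomorphism of a Cantor space all of whose two-sided orbits are dense). They are isomorphic (conjugate) if there is a homeomorphism $h:X\to Y$ with $h\circ T=S\circ h$. They are orbit equivalent if there is a homeomorphism $h:X\to Y$ with $h(\mathrm{Orb}_T(x))=\mathrm{Orb}_S(h(x))$ for all $x$, where $\mathrm{Orb}_T(x)=\{T^n(x):n\in\mathbb Z\}$; then there are functions (orbit cocycles) $n,m:X\to\mathbb Z$ with $h\circ T(x)=S^{n(x)}\circ h(x)$ and $h\circ T^{m(x)}(x)=S\circ h(x)$. They are strong orbit equivalent if they are orbit equivalent via some $h$ for which each of the two orbit cocycles has at most one point of discontinuity. *)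

(* Defs.v *)
From HB Require Import structures.
From mathcomp Require Import all_boot all_order all_algebra.
From mathcomp Require Import all_classical all_reals all_analysis.

Set Implicit Arguments.
Unset Strict Implicit.
Unset Printing Implicit Defensive.

Import GRing.Theory.
Local Open Scope classical_set_scope.

(* [edge B n] is the set E_{n+1} of edges from V_n to V_{n+1}: edge sets are
   indexed by the level of their sources. *)
Record bratteli := Bratteli {
  vertex : nat -> finType;
  edge : nat -> finType;
  src : forall n, edge n -> vertex n;
  rng : forall n, edge n -> vertex n.+1;
  card_vertex0 : #|vertex 0| = 1;
  src_surj : forall n (v : vertex n), exists e : edge n, src e = v;
  rng_surj : forall n (v : vertex n.+1), exists e : edge n, rng e = v }.

Arguments src {B n} e : rename.
Arguments rng {B n} e : rename.

Section FinitePaths.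
Variable B : bratteli.

Record path_set (i k : nat) := PathSet {
  path_sort :> finType;
  path_src : path_sort -> vertex B i;
  path_tgt : path_sort -> vertex B (k + i) }.

(* The finite paths of length k starting at level i, hence ending at level
   k + i. A path of length 0 is a vertex; a path of length k + 1 is a path of
   length k followed by an edge. The order of the summands in [k + i] makes
   [k.+1 + i] and [(k + i).+1] convertible. *)
Fixpoint fpath (i k : nat) : path_set i k :=
  match k return path_set i k with
  | 0 => @PathSet i 0 (vertex B i) id id
  | k'.+1 =>
      let P := fpath i k' in
      @PathSet i k'.+1
        {pe : (P * edge B (k' + i))%type | path_tgt pe.1 == src pe.2}
        (fun pe => path_src (val pe).1)
        (fun pe => rng (val pe).2)
  end.

Lemma fpath_src_surj i k (v : vertex B i) :
  exists p : fpath i k, path_src p = v.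
Proof.
elim: k => [|k [p pv]]; first by exists v.
have [e eE] := src_surj (path_tgt p).
have pe : path_tgt (p, e).1 == src (p, e).2 by rewrite /= eE.
by exists (exist _ (p, e) pe).
Qed.

Lemma fpath_tgt_surj i k (v : vertex B (k + i)) :
  exists p : fpath i k, path_tgt p = v.
Proof.
elim: k v => [|k IH] v; first by exists v.
have [e ev] := @rng_surj B (k + i) v; have [p pE] := IH (src e).
have pe : path_tgt (p, e).1 == src (p, e).2 by rewrite /= pE.
by exists (exist _ (p, e) pe).
Qed.

Definition is_path (x : forall n, edge B n) : Prop :=
  forall n, rng (x n) = src (x n.+1).

Definition simple_diagram : Prop :=
  forall n, 0 < n -> exists2 k, 0 < k &
    forall (v : vertex B n) (w : vertex B (k + n)),
      exists p : fpath n k, path_src p = v /\ path_tgt p = w.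

Definition incidence n (v : vertex B n.+1) (w : vertex B n) : nat :=
  #|[pred e : edge B n | (rng e == v) && (src e == w)]|.

Definition no_multiple_edges01 : Prop :=
  forall e f : edge B 0, src e = src f -> rng e = rng f -> e = f.

End FinitePaths.

(* A sequence 0 = m_0 < m_1 < ... is given by its increments
   d_n = m_{n+1} - m_n > 0, so that [tlevel d n.+1] is convertible to
   [d n + tlevel d n] and no transport between levels is needed. *)
Fixpoint tlevel (d : nat -> nat) (n : nat) : nat :=
  if n is n'.+1 then d n' + tlevel d n' else 0.

Definition telescoping (B : bratteli) (d : nat -> nat) : bratteli :=
  @Bratteli (fun n => vertex B (tlevel d n))
    (fun n => fpath B (tlevel d n) (d n))
    (fun n => @path_src B (tlevel d n) (d n) (fpath B (tlevel d n) (d n)))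
    (fun n => @path_tgt B (tlevel d n) (d n) (fpath B (tlevel d n) (d n)))
    (card_vertex0 B)
    (fun n => @fpath_src_surj B (tlevel d n) (d n))
    (fun n => @fpath_tgt_surj B (tlevel d n) (d n)).

Section Orders.
Variable B : bratteli.

(* Only the comparisons of edges with the same range are meaningful. *)
Definition edge_rel := forall n, rel (edge B n).

Variable le : edge_rel.

Definition is_order : Prop :=
  forall n (v : vertex B n.+1), let In := [pred e | rng e == v] in
  [/\ {in In, reflexive (@le n)}, {in In &, antisymmetric (@le n)},
      {in In & &, transitive (@le n)} & {in In &, total (@le n)}].

Definition max_edge n (e : edge B n) : Prop :=
  forall f : edge B n, rng f = rng e -> le f e.

Definition min_edge n (e : edge B n) : Prop :=
  forall f : edge B n, rng f = rng e -> le e f.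

Definition proper_order : Prop :=
  (exists! x : forall n, edge B n, is_path x /\ forall n, max_edge (x n)) /\
  (exists! x : forall n, edge B n, is_path x /\ forall n, min_edge (x n)).

Definition ordered_edges n (v : vertex B n.+1) : seq (edge B n) :=
  sort (@le n) (enum [pred e : edge B n | rng e == v]).

End Orders.

Section Stationary.
Variables (B : bratteli) (A : finType).

(* [lab n a] is the vertex v_{n+1}(a): the levels n >= 1 are labelled. *)
Definition labelling := forall n, A -> vertex B n.+1.

Variables (lab : labelling) (le : edge_rel B).

Definition stationary : Prop :=
  (forall n, bijective (lab n)) /\
  forall n a b, incidence (lab n.+2 a) (lab n.+1 b)
              = incidence (lab 1 a) (lab 0 b).

(* The order on E_{n+2} is that on E_2 once these sets are identified
   compatibly with the labels of sources and ranges. *)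
Definition stationary_ordered : Prop :=
  stationary /\
  forall n, exists phi : edge B 1 -> edge B n.+1,
    [/\ bijective phi,
        forall e a, rng e = lab 1 a -> rng (phi e) = lab n.+1 a,
        forall e a, src e = lab 0 a -> src (phi e) = lab n a &
        forall e f, rng e = rng f -> le (phi e) (phi f) = le e f].

(* [sigma a] is the sequence of labels of the sources of the ordered list of
   edges with range v_{n+2}(a). It is non-empty since [rng] is surjective. *)
Definition reads (sigma : A -> seq A) : Prop :=
  forall n a, [seq lab n b | b <- sigma a]
            = [seq src e | e <- ordered_edges le (lab n.+1 a)].

End Stationary.

Definition homeomorphism (X Y : topologicalType) (h : X -> Y) : Prop :=
  exists g : Y -> X,
    [/\ cancel h g, cancel g h, continuous h & continuous g].

(* [cantor_like] is not used since the empty space satisfies it. *)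
Definition cantor_set (X : topologicalType) : Prop :=
  exists h : cantor_space -> X, homeomorphism h.

Record dynsys := DynSys {
  space :> topologicalType;
  dmap : space -> space;
  dinv : space -> space;
  dmapK : cancel dmap dinv;
  dinvK : cancel dinv dmap;
  dmap_continuous : continuous dmap;
  dinv_continuous : continuous dinv }.

Arguments dmap {d} x : rename.
Arguments dinv {d} x : rename.

(* T^n for n in Z; recall that [Negz k] is - k.+1. *)
Definition zpow (X : dynsys) (n : int) (x : X) : X :=
  match n with
  | Posz k => iter k dmap x
  | Negz k => iter k.+1 dinv x
  end.

Definition dorbit (X : dynsys) (x : X) : set X := range (fun n => zpow n x).

Definition isomorphic (X Y : dynsys) : Prop :=
  exists2 h : X -> Y, homeomorphism h & forall x, h (dmap x) = dmap (h x).

Definition orbit_equivalence (X Y : dynsys) (h : X -> Y) : Prop :=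
  homeomorphism h /\ forall x, h @` dorbit x = dorbit (h x).

Definition at_most_one_discontinuity (X : topologicalType) (n : X -> int) :=
  forall x y : X,
    ~ {for x, continuous (n : X -> discrete_topology int)} ->
    ~ {for y, continuous (n : X -> discrete_topology int)} -> x = y.

Definition strong_orbit_equivalent (X Y : dynsys) : Prop :=
  exists h : X -> Y, orbit_equivalence h /\
  exists n m : X -> int,
    [/\ forall x, h (dmap x) = zpow (n x) (h x),
        forall x, h (zpow (m x) x) = dmap (h x),
        at_most_one_discontinuity n &
        at_most_one_discontinuity m].

Lemma prod_continuous (X : topologicalType) (I : Type)
    (T : I -> topologicalType) (f : X -> prod_topology T) :
  (forall i, continuous (fun x => f x i)) -> continuous f.
Proof.
move=> cf x; apply/cvg_sup => i U [V [[W oW <-] Wx] VU].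
move: (cf i x W (open_nbhs_nbhs (conj oW Wx))).
by apply: (@filterS X (nbhs x) (nbhs_filter x)) => y Wy; exact: VU.
Qed.

Section Substitution.
Variables (A : finType) (sigma : A -> seq A).

Definition subst_word (w : seq A) : seq A := flatten [seq sigma a | a <- w].

Definition subst_iter (n : nat) (a : A) : seq A := iter n subst_word [:: a].

Definition primitive_subst : Prop :=
  exists n, forall a b : A, b \in subst_iter n a.

Definition language : set (seq A) :=
  [set w | exists n a, infix w (subst_iter n a)].

Definition full_shift := prod_topology (fun _ : int => discrete_topology A).

Definition subword (x : int -> A) (i : int) (k : nat) : seq A :=
  [seq x (i + j%:Z)%R | j <- iota 0 k].

Definition subst_space : set full_shift :=
  [set x | forall i k, language (subword x i k)].

Definition translate (c : int) (x : full_shift) : full_shift :=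
  fun i => x (i + c)%R.

Lemma translate_subproof (c : int) (x : subst_space) :
  translate c (set_val x) \in subst_space.
Proof.
apply/mem_set => i k; have /(_ (i + c)%R k) := set_valP x.
by congr (language _); apply: eq_map => j; rewrite /translate addrAC.
Qed.

Definition sub_translate (c : int) (x : subst_space) : subst_space :=
  exist _ (translate c (set_val x)) (translate_subproof c x).

Lemma sub_translateK (c c' : int) : (c + c' = 0)%R ->
  cancel (sub_translate c) (sub_translate c').
Proof.
move=> cc' x; apply: val_inj; apply: funext => i /=.
by rewrite /translate -[LHS]/(set_val x (i + c' + c)%R) -addrA [(c' + c)%R]addrC
  cc' addr0.
Qed.

Lemma translate_continuous (c : int) : continuous (translate c).
Proof.
apply: (@prod_continuous full_shift int (fun=> discrete_topology A)) => i.
exact: (@proj_continuous int (fun=> discrete_topology A) (i + c)%R).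
Qed.

Lemma sub_translate_continuous (c : int) : continuous (sub_translate c).
Proof.
apply: continuous_comp_initial => x.
apply: (@continuous_comp _ _ _ set_val (translate c)).
  exact: initial_continuous.
exact: translate_continuous.
Qed.

Definition subst_system : dynsys :=
  @DynSys subst_space (sub_translate 1) (sub_translate (-1))
    (sub_translateK (subrr 1%R)) (sub_translateK (addNr 1%R))
    (@sub_translate_continuous 1) (@sub_translate_continuous (-1)).

End Substitution.

(* Main.v *)
(** Some power [t] of [sigma] has words [t a] that all begin with the same letter [l], all
    end with the same letter [r], and contain every letter as often as we like; this is
    where properness of the order enters. Permuting the interior of each [t a] gives words
    [zeta a] that form a prefix code and contain a long run of [l]. The letter counts
    of [t a] are those of the incidence matrix of a telescoping, so [zeta] is read on this
    telescoping with another proper order.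

    Points of the two subshifts are coded by infinite paths of the same diagram. A bijection
    between the edges that preserves ranges, sources, first and last edges transports one
    coding to the other. It preserves cofinality of paths, and the orbit cocycle is computed
    from a finite initial part of a path unless all its edges are maximal.

    The coding is injective (recognizability). Two paths with the same point, preceded by
    [i] minimal edges, form pairs of paths with the same point that separate at depth about
    [i]. For large [j], the word [t ^ (j - 1) (l)] is a prefix of all words [t ^ j (a)]; as powers
    in the language are bounded, its occurrences are sparse, so the two words of level [j]
    around the base point overlap in boundedly many ways. Two values of [i] thus give the
    same overlap, although the overlap determines the depth of separation.

    A run of [l] of length [g] in [zeta] gives arbitrarily long words [w] with [w ^ g] in the
    language, and an isomorphism, being a sliding block code, lowers the exponent by at most
    one. The exponents in the language of a given aperiodic [zeta] are bounded, so letting [g]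
    grow fast enough gives pairwise non-isomorphic systems. *)

Require Import Defs.
From mathcomp Require Import all_boot all_algebra.
From mathcomp Require Import zify.
From mathcomp Require Import boolp classical_sets functions filter topology cantor.

Set Implicit Arguments.
Unset Strict Implicit.
Unset Printing Implicit Defensive.

Import GRing.Theory.

(** * Words *)

Lemma infix_catP (T : eqType) (v x y : seq T) : infix v (x ++ y) ->
  [\/ infix v x, infix v y |
      exists v1 v2, [/\ v = v1 ++ v2, v1 != [::], suffix v1 x & prefix v2 y]].
Proof.
move=> /infixP [p [q /esym E]].
have [le1|lt1] := leqP (size x) (size p).
  apply: Or32; apply/infixP; exists (drop (size x) p), q.
  move/(congr1 (drop (size x))): E; rewrite (drop_size_cat y) // => <-.
  by rewrite drop_cat; case: ltngtP le1 => // e _; rewrite e subnn drop0 drop_size.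
have xE : x = p ++ drop (size p) x.
  move/(congr1 (take (size p))): E; rewrite take_size_cat // takel_cat ?(ltnW lt1) //.
  by move=> {1}->; rewrite cat_take_drop.
move: (drop (size p) x) xE => z xE; rewrite xE -catA in E *.
move/eqP: E; rewrite eqseq_cat // eqxx /= => /eqP E.
have [le2|lt2] := leqP (size v) (size z).
  apply: Or31; apply/infixP; exists p, (drop (size v) z).
  congr cat; rewrite -{1}(cat_take_drop (size v) z); congr cat.
  by move/(congr1 (take (size v))): E; rewrite take_size_cat // takel_cat.
apply: Or33; exists z, (drop (size z) v); split.
- move/(congr1 (take (size z))): E; rewrite (take_size_cat y) // takel_cat ?(ltnW lt2) //.
  by move=> {1}<-; rewrite cat_take_drop.
- by apply/eqP => z0; move: lt1; rewrite xE z0 cats0 ltnn.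
- exact: suffix_suffix.
- move/(congr1 (drop (size z))): E; rewrite (drop_size_cat y) // drop_cat lt2 => <-.
  exact: prefix_prefix.
Qed.

Lemma suffix_catr (T : eqType) (u x y : seq T) :
  suffix u (x ++ y) -> size u <= size y -> suffix u y.
Proof.
move=> /suffixP [z E] le.
apply/suffixP; exists (drop (size x) z).
have sz : size x <= size z by move/(congr1 size): E; rewrite !size_cat; lia.
move/(congr1 (drop (size x))): E; rewrite (drop_size_cat y) // drop_cat => ->.
by case: ltngtP sz => // e _; rewrite e subnn drop0 drop_size.
Qed.

Lemma prefix_catl (T : eqType) (u x y : seq T) :
  prefix u (x ++ y) -> size u <= size x -> prefix u x.
Proof. by rewrite !prefixE => + le; rewrite takel_cat. Qed.

(** * Iterated images, languages and periods of words *)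

Section Words.
Variables (A : finType) (s : A -> seq A).

Notation I n := (iter n (subst_word s)).
Notation W := (subst_iter s).

Lemma subst_word_cat u v : subst_word s (u ++ v) = subst_word s u ++ subst_word s v.
Proof. by rewrite /subst_word map_cat flatten_cat. Qed.

Lemma iter_subst_cat n u v : I n (u ++ v) = I n u ++ I n v.
Proof. by elim: n => //= n ->; rewrite subst_word_cat. Qed.

Lemma iter_subst_nil n : I n [::] = [::].
Proof. by elim: n => //= n ->. Qed.

Lemma iter_subst_cons n a v : I n (a :: v) = W n a ++ I n v.
Proof. by rewrite -cat1s iter_subst_cat. Qed.

Lemma iter_subst_rcons n v a : I n (rcons v a) = I n v ++ W n a.
Proof. by rewrite -cats1 iter_subst_cat. Qed.

Lemma subst_iterS n a : W n.+1 a = I n (s a).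
Proof. by rewrite /subst_iter iterSr /subst_word /= cats0. Qed.

Lemma subst_iterD m n a : W (m + n) a = I m (W n a).
Proof. by rewrite /subst_iter iterD. Qed.

Lemma subst_iter1 a : W 1 a = s a.
Proof. by rewrite subst_iterS. Qed.

Lemma infix_iter_subst n u v : infix u v -> infix (I n u) (I n v).
Proof.
by move=> /infixP [p [q ->]]; rewrite !iter_subst_cat infix_infix.
Qed.

Lemma mem_infix_iter_subst n a w : a \in w -> infix (W n a) (I n w).
Proof.
by case/splitPr => p q; rewrite iter_subst_cat iter_subst_cons infix_infix.
Qed.

Lemma leq_size_iter_subst_take n w k k' : k <= k' ->
  size (I n (take k w)) <= size (I n (take k' w)).
Proof.
move=> le; rewrite -(take_takel w le) -{2}(cat_take_drop k (take k' w)).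
by rewrite iter_subst_cat size_cat leq_addr.
Qed.

Lemma iter_subst_split n w k a0 : k < size w ->
  I n w = I n (take k w) ++ W n (nth a0 w k) ++ I n (drop k.+1 w).
Proof.
move=> lt; rewrite -{1}(cat_take_drop k w) (drop_nth a0 lt).
by rewrite iter_subst_cat iter_subst_cons.
Qed.

Lemma size_iter_subst_takeS n w k a0 : k < size w ->
  size (I n (take k.+1 w)) = size (I n (take k w)) + size (W n (nth a0 w k)).
Proof. by move=> lt; rewrite (take_nth a0 lt) iter_subst_rcons size_cat. Qed.

(** A position in [I n w] has coordinates: the index of the letter whose image covers it, and the
    offset in this image. Paths are compared, and by the next lemma built, level by level through
    these coordinates. *)
Lemma iter_subst_offset_inj n w a0 k k' p p' : k < size w -> k' < size w ->
  p < size (W n (nth a0 w k)) -> p' < size (W n (nth a0 w k')) ->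
  size (I n (take k w)) + p = size (I n (take k' w)) + p' -> k = k' /\ p = p'.
Proof.
move=> lk lk' lp lp' E.
have [lt|gt|kk] := ltngtP k k'.
- have := leq_size_iter_subst_take n w lt; rewrite (size_iter_subst_takeS n a0 lk); lia.
- have := leq_size_iter_subst_take n w gt; rewrite (size_iter_subst_takeS n a0 lk'); lia.
- by move: E; rewrite kk; lia.
Qed.

Lemma iter_subst_offset n w a0 q : q < size (I n w) ->
  exists k p, [/\ k < size w, p < size (W n (nth a0 w k)) &
    q = size (I n (take k w)) + p].
Proof.
elim/last_ind: w => [|w a IH]; first by rewrite iter_subst_nil.
rewrite iter_subst_rcons size_cat => lq.
have [lt|ge] := ltnP q (size (I n w)).
  have [k [p [lk lp E]]] := IH lt; exists k, p; split.
  - by rewrite size_rcons ltnW.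
  - by rewrite nth_rcons lk.
  - by rewrite E -cats1 takel_cat // ltnW.
exists (size w), (q - size (I n w)); split.
- by rewrite size_rcons.
- by rewrite nth_rcons ltnn eqxx; lia.
- by rewrite -cats1 take_size_cat //; lia.
Qed.

Lemma language_infix u v : infix u v -> language s v -> language s u.
Proof. by move=> uv [n [a va]]; exists n, a; apply: infix_trans va. Qed.

Lemma language_iter n v : language s v -> language s (I n v).
Proof.
by move=> [m [a va]]; exists (n + m), a; rewrite subst_iterD infix_iter_subst.
Qed.

(** Exponents are measured by comparing [size v] with [d], so fractional powers count as well. *)
Definition has_period a0 d (v : seq A) := forall i, i + d < size v ->
  nth a0 v i = nth a0 v (i + d).

(** Words of length [d.+1] suffice: two different letters at distance [d] bound such a word, and the
    language is closed under subwords. *)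
Definition aperiodic a0 := forall d, 0 < d -> exists2 v, language s v &
  size v = d.+1 /\ nth a0 v 0 != nth a0 v d.

(** With all letters in the interior, every letter occurs in every [s a] with a neighbour on each
    side. *)
Definition proper_subst (l r : A) := forall a, exists w,
  s a = l :: rcons w r /\ forall b, b \in w.

(** * Proper substitutions: block boundaries and bounded powers *)

Section Proper.
Variables (l r : A).
Hypothesis sP : proper_subst l r.

Lemma proper_mem a b : b \in s a.
Proof. by have [w [-> /(_ b) bw]] := sP a; rewrite inE mem_rcons inE bw !orbT. Qed.

Lemma proper_size a : 2 < size (s a).
Proof.
have [w [-> /(_ a)]] := sP a; rewrite /= size_rcons.
by case: w.
Qed.

Lemma proper_head a : nth l (s a) 0 = l.
Proof. by have [w [-> _]] := sP a. Qed.

Lemma proper_last a : nth l (s a) (size (s a)).-1 = r.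
Proof. by have [w [-> _]] := sP a; rewrite nth_last /= last_rcons. Qed.

Lemma ltn_size_subst_iter n a : n < size (W n a).
Proof.
suff H w : 2 ^ n * size w <= size (I n w).
  by apply: leq_trans (H [:: a]); rewrite muln1 ltn_expl.
elim: n w => [|n IH] w; first by rewrite mul1n.
rewrite iterSr; apply: leq_trans (IH _); rewrite expnSr -mulnA leq_mul2l; apply/orP; right.
elim: w => // c w' IHw; rewrite /subst_word /= size_cat mulnS leq_add //.
exact: ltnW (proper_size c).
Qed.

Lemma proper_prefix n a : exists x, W n.+1 a = W n l ++ x.
Proof.
have [w [E _]] := sP a; exists (I n (rcons w r)).
by rewrite subst_iterS E iter_subst_cons.
Qed.

Lemma proper_suffix n a : exists x, W n.+1 a = x ++ W n r.
Proof.
have [w [E _]] := sP a; exists (I n (l :: w)).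
by rewrite subst_iterS E -rcons_cons iter_subst_rcons.
Qed.

Lemma iter_proper_prefix n w : w != [::] -> exists x, I n.+1 w = W n l ++ x.
Proof.
case: w => // a w _; have [x E] := proper_prefix n a.
by exists (x ++ I n.+1 w); rewrite iter_subst_cons E catA.
Qed.

Lemma iter_proper_suffix n w : w != [::] -> exists x, I n.+1 w = x ++ W n r.
Proof.
case/lastP: w => // w a _; have [x E] := proper_suffix n a.
by exists (I n.+1 w ++ x); rewrite iter_subst_rcons E catA.
Qed.

Lemma proper_context a b : exists e f, infix [:: e; a; f] (s b).
Proof.
have [w [-> /(_ a)]] := sP b; case/splitPr => w1 w2.
case/lastP: w1 => [|w1 e]; case: w2 => [|f w2].
- by exists l, r; apply/infixP; exists [::], [::].
- by exists l, f; apply/infixP; exists [::], (rcons w2 r).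
- exists e, r; apply/infixP; exists (l :: w1), [::].
  by rewrite rcons_cat cat_rcons.
- exists e, f; apply/infixP; exists (l :: w1), (rcons w2 r).
  by rewrite rcons_cat cat_rcons.
Qed.

Lemma infix_subst_iterS n a b : infix (W n a) (W n.+1 b).
Proof. by rewrite subst_iterS mem_infix_iter_subst // proper_mem. Qed.

Lemma infix_subst_iter_lt n m a b : n < m -> infix (W n a) (W m b).
Proof.
move=> /subnK <-; rewrite addnS -addSn addnC.
elim: (m - n.+1) b => [|k IH] b; first by rewrite addn1 infix_subst_iterS.
by rewrite addnS; apply: infix_trans (infix_subst_iterS _ b b); exact: IH.
Qed.

(** The letter [a] occurs in [s a] between two letters, whose images under [W n.+1] end with [W n r]
    and begin with [W n l]. These words are the windows attached to paths below. *)
Lemma language_context n a : language s (W n r ++ W n.+1 a ++ W n l).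
Proof.
have [e [f eaf]] := proper_context a a.
exists n.+2, a; rewrite (subst_iterS n.+1); apply: infix_trans (infix_iter_subst _ eaf).
rewrite !iter_subst_cons iter_subst_nil cats0.
have [x ->] := proper_suffix n e; have [y ->] := proper_prefix n f.
by apply/infixP; exists x, y; rewrite !catA.
Qed.

Definition max_size := \max_a size (s a).

Lemma leq_size_iter_subst n w : size (I n w) <= max_size ^ n * size w.
Proof.
elim: n w => [|n IH] w; first by rewrite mul1n.
rewrite iterSr; apply: leq_trans (IH _) _; rewrite expnSr -mulnA leq_mul2l; apply/orP; right.
elim: w => // a w' IHw; rewrite /subst_word /= size_cat mulnS leq_add //.
exact: (@leq_bigmax _ (fun a => size (s a))).
Qed.

Lemma leq_size_subst_iter n a b : size (W n a) <= max_size * size (W n b).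
Proof.
case: n => [|n].
  rewrite muln1; apply: leq_trans (@leq_bigmax _ (fun a => size (s a)) a).
  exact: leq_trans (proper_size a).
rewrite subst_iterS.
apply: (@leq_trans (size (s a) * size (W n.+1 b))); last first.
  by rewrite leq_mul2r (@leq_bigmax _ (fun a => size (s a))) orbT.
elim: (s a) => [|c w IH]; first by rewrite iter_subst_nil.
rewrite iter_subst_cons size_cat mulSn leq_add // size_infix //.
exact: infix_subst_iterS.
Qed.

(** In a concatenation of blocks of level [n.+1], a short word lies in one block or meets a single
    boundary, around which the blocks read [W n r] and [W n l] whatever the letters are. Such a
    boundary occurs inside each [W n.+3 c]. *)
Lemma short_word_infix n v c : language s v ->
  size v <= size (W n l) -> size v <= size (W n r) -> infix v (W n.+3 c).
Proof.
move=> [N [b vb]] vl vr.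
have {vb} : infix v (I n.+1 (W N b)).
  rewrite -subst_iterD addnC; apply: infix_trans vb _.
  by rewrite infix_subst_iter_lt // addnS ltnS leq_addr.
have key : infix v (W n r ++ W n l) -> infix v (W n.+3 c).
  move=> /infix_trans; apply; rewrite subst_iterS.
  have [w [-> /(_ c)]] := sP c; case: w => // a w _.
  rewrite rcons_cons !iter_subst_cons catA; apply: infix_catr.
  have [x ->] := proper_suffix n.+1 l; have [y ->] := proper_prefix n.+1 a.
  have [x' ->] := proper_suffix n r; have [y' ->] := proper_prefix n l.
  by apply/infixP; exists (x ++ x'), (y' ++ y); rewrite !catA.
elim: (W N b) => [|a w IH].
  by rewrite iter_subst_nil infixs0 => /eqP ->; exact: prefixW (prefix0s _).
rewrite iter_subst_cons => /infix_catP [va|/IH //|].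
  by apply: infix_trans va _; rewrite infix_subst_iter_lt.
move=> [v1 [v2 [E v10 s1 p2]]]; apply: key; rewrite E.
case: w p2 {IH} => [|a' w] p2.
  move: p2; rewrite iter_subst_nil prefixs0 => /eqP v20.
  have [x Ex] := proper_suffix n a; move: s1; rewrite Ex => /suffix_catr.
  rewrite E v20 cats0 in vr * => /(_ vr) /suffixP [y ->].
  by rewrite -catA; apply/infixP; exists y, (W n l).
have [x Ex] := proper_suffix n a; move: s1; rewrite Ex => /suffix_catr s1.
have /suffixP [y ->] : suffix v1 (W n r).
  by apply: s1; apply: leq_trans vr; rewrite E size_cat leq_addr.
have [z Ez] := @iter_proper_prefix n (a' :: w) isT; move: p2; rewrite Ez.
move=> /prefix_catl p2.
have /prefixP [t ->] : prefix v2 (W n l).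
  by apply: p2; apply: leq_trans vl; rewrite E size_cat leq_addl.
by apply/infixP; exists y, t; rewrite !catA.
Qed.

(** A block has at most half the length of [v], so an occurrence that crosses the end of the first
    block it meets has enough letters left for the whole next block. *)
Lemma long_word_infix k v : language s v ->
  (forall a, 2 * size (W k a) <= size v) -> exists a, infix (W k a) v.
Proof.
move=> [N [b vb]] big.
have {vb} : infix v (I k (W N.+1 b)).
  rewrite -subst_iterD; apply: infix_trans vb _.
  by rewrite infix_subst_iter_lt // addnS ltnS leq_addl.
have B a : 0 < size (W k a) by exact: leq_ltn_trans (ltn_size_subst_iter k a).
have P w y : prefix y (I k w) -> 0 < size y -> (forall a, size (W k a) <= size y) ->
    exists a, infix (W k a) y.
  case: w => [|a w]; first by rewrite iter_subst_nil prefixs0 => /eqP ->.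
  rewrite iter_subst_cons => /prefixP [z E] _ /(_ a) le; exists a.
  apply: prefixW; rewrite prefixE -(takel_cat z le) -E.
  by rewrite take_size_cat.
elim: (W N.+1 b) => [|a w IH].
  rewrite iter_subst_nil infixs0 => /eqP v0; move: (big b) (B b); rewrite v0 /=; lia.
rewrite iter_subst_cons => /infix_catP [va|/IH //|].
  have {}va : size v <= size (W k a) := size_infix va.
  by move: (big a) (B a); lia.
move=> [v1 [v2 [E v10 s1 p2]]].
have {}s1 : size v1 <= size (W k a) := size_suffix s1.
have S2 : size v2 = size v - size v1 by rewrite E size_cat addKn.
have [||c cv2] := P w v2 p2.
- by move: (big a) (B a); lia.
- move=> c; move: (big a) (big c); lia.
by exists c; rewrite E infix_catl.
Qed.

(** Take the least level at which the blocks of [l] and [r] are both longer than [d]. Three levels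
    higher all blocks have length at most [max_size ^ 5 * d]. A word of twice this length contains
    such a block, hence all words of length [d.+1] of the language, and one of these violates the
    period [d]. *)
Lemma bounded_powers a0 : aperiodic a0 -> exists Q, forall v d,
  language s v -> 0 < d -> has_period a0 d v -> size v < Q * d.
Proof.
move=> ap; exists (2 * max_size ^ 5) => v d Lv d0 per; rewrite ltnNge; apply/negP => le.
have ex : exists n, (d < size (W n l)) && (d < size (W n r)).
  by exists d; rewrite !ltn_size_subst_iter.
have := ex_minnP ex => -[[|n]] /andP [nl nr] nmin.
  by move: nl d0; rewrite /= ltnS leqn0 => /eqP ->.
have bnd c : size (W (4 + n) c) <= max_size ^ 5 * d.
  rewrite subst_iterD; apply: leq_trans (leq_size_iter_subst _ _) _.
  rewrite (expnSr _ 4) -mulnA leq_mul2l; apply/orP; right.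
  (* By minimality one of the two blocks of level [n] has length at most [d], and the lengths of
     blocks of one level agree up to the factor [max_size]. *)
  have [lel|ltl] := leqP (size (W n l)) d.
    by apply: leq_trans (leq_size_subst_iter n c l) _; rewrite leq_mul2l lel orbT.
  have [ler|ltr] := leqP (size (W n r)) d.
    by apply: leq_trans (leq_size_subst_iter n c r) _; rewrite leq_mul2l ler orbT.
  by have := nmin n; rewrite ltl ltr => /(_ isT); rewrite ltnn.
have [c cv] : exists a, infix (W (4 + n) a) v.
  by apply: long_word_infix => // a; move: (bnd a) le; rewrite -mulnA; lia.
have [u Lu [su]] := ap d d0; apply/negP; rewrite negbK; apply/eqP.
have /infixP [x [y E]] : infix u v.
  by apply: infix_trans cv; apply: short_word_infix; rewrite ?su.
have := per (size x); rewrite E !size_cat su ltn_add2l addSn ltnS leq_addr => /(_ isT).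
by rewrite !nth_cat ltnn subnn su /= ltnNge leq_addr /= addKn ltnSn.
Qed.

(** If [d] is a period of the whole language, all blocks [W d.+1 a] are initial parts of one
    periodic sequence [f], and their lengths are periods of [f]. So any two of them commute, and an
    injective map would identify [[:: a; b]] with [[:: b; a]]. *)
Lemma aperiodic_of_injective a0 : 1 < #|A| -> injective (subst_word s) -> aperiodic a0.
Proof.
move=> A2 inj d d0.
have [//|no] := EM (exists2 v, language s v & size v = d.+1 /\ nth a0 v 0 != nth a0 v d).
have per v : language s v -> has_period a0 d v.
  move=> Lv i lt; apply/eqP/negPn/negP => ne; apply: no.
  exists (take d.+1 (drop i v)).
    by apply: language_infix Lv; apply: infix_trans (infix_take _ _) (infix_drop _ _).
  by rewrite size_takel ?size_drop ?nth_take ?nth_drop ?addn0 //; lia.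
pose u := W d l; have ud : d < size u := ltn_size_subst_iter d l.
pose f i := nth a0 u (i %% d).
have fE v : language s v -> prefix u v -> forall i, i < size v -> nth a0 v i = f i.
  move=> Lv /prefixP [z vE]; elim/ltn_ind => i IH lt.
  have [lid|di] := ltnP i d.
    by rewrite /f modn_small // vE nth_cat (ltn_trans lid).
  have := per v Lv (i - d); rewrite subnK // => <- //.
  by rewrite IH /f; [rewrite -{2}(subnK di) modnDr|lia|lia].
pose B a := W d.+1 a.
have Bf a i : i < size (B a) -> nth a0 (B a) i = f i.
  apply: fE; first by exists d.+1, a; exact: infix_refl.
  by have [x E] := proper_prefix d a; rewrite /B E prefix_prefix.
have uf i : i < size u -> nth a0 u i = f i.
  by apply: fE; [exists d, l; exact: infix_refl | exact: prefix_refl].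
(* [B a] can be followed by [u], which is longer than [d]; comparing this [u] with the beginning of
   [f] gives the period [size (B a)]. *)
have fB a i : f (size (B a) + i) = f i.
  have -> : f (size (B a) + i) = f (size (B a) + i %% d) by rewrite /f modnDmr.
  have -> : f i = nth a0 u (i %% d) by [].
  have Lau : language s (B a ++ u).
    apply: language_infix (language_context d a).
    exact: suffix_infix.
  have id : i %% d < size u by apply: ltn_trans ud; rewrite ltn_mod.
  rewrite -(fE _ Lau) ?size_cat ?ltn_add2l //.
    by rewrite nth_cat ltnNge leq_addr /= addKn.
  have [x E] := proper_prefix d a.
  by rewrite /B E -catA prefix_prefix.
have comm a b : B a ++ B b = mkseq f (size (B a) + size (B b)).
  apply: (@eq_from_nth _ a0) => [|i]; first by rewrite size_cat size_mkseq.
  rewrite size_cat => lt; rewrite nth_mkseq // nth_cat.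
  case: ltnP => [/Bf //|le].
  by rewrite Bf ?ltn_subLR // -(fB a) subnKC.
have [a [b ab]] : exists a b : A, a != b.
  have [a [b]] := card_gt1P A2.
  by move=> [_ _ ab]; exists a, b.
have injI n : injective (I n) by elim: n => //= n IH x y /inj /IH.
have : [:: a; b] = [:: b; a].
  apply: (injI d.+1); rewrite !iter_subst_cons iter_subst_nil !cats0.
  by rewrite !comm addnC.
by move=> [/eqP]; rewrite (negPf ab).
Qed.

End Proper.
End Words.

(** * Paths and the points they code *)

Section Paths.
Variables (A : finType) (s : A -> seq A) (l r : A).

Notation I n := (iter n (subst_word s)).
Notation W := (subst_iter s).

(* [(a, k) = x n] stands for the edge of E_{n+2} with range v_{n+2}(a) and
   rank k; the edge of E_1 is determined by the source of [x 0]. *)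
Definition path_letter (x : nat -> A * nat) n :=
  if n is m.+1 then (x m).1 else nth l (s (x 0).1) (x 0).2.

Definition valid_path (x : nat -> A * nat) := forall n,
  (x n).2 < size (s (x n).1) /\ nth l (s (x n).1) (x n).2 = path_letter x n.

(* The position of the base point of the path in the word [W n (path_letter x n)]. *)
Fixpoint path_pos (x : nat -> A * nat) n :=
  if n is m.+1 then size (I m (take (x m).2 (s (x m).1))) + path_pos x m else 0.

(** Whatever blocks of level [n.+1] surround the central one, they end with [W n r] and begin with
    [W n l]. These margins let the windows exhaust both directions even when all edges of the path
    are minimal or maximal. *)
Definition path_window x n := W n r ++ W n.+1 (path_letter x n.+1) ++ W n l.
Definition path_base x n := size (W n r) + path_pos x n.+1.

(** The window of index [|i|] reaches at least [|i|] letters to both sides of the base point, so the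
    default [l] does not occur for valid paths. *)
Definition path_point x (i : int) : A :=
  nth l (path_window x `|i|) `|((path_base x `|i|)%:Z + i)%R|.

Definition path_shift N (x : nat -> A * nat) n := x (N + n).
(** When [a] is the first letter of the path, prepending [(a, k)] applies [s] to the coded point and
    shifts by [k]; minimal edges have [k = 0]. *)
Definition path_cons (e : A * nat) x n : A * nat := if n is m.+1 then x m else e.
Definition path_min x := path_cons (path_letter x 0, 0) x.

Lemma path_split x n : valid_path x ->
  W n.+1 (path_letter x n.+1) = I n (take (x n).2 (s (x n).1)) ++
    W n (path_letter x n) ++ I n (drop (x n).2.+1 (s (x n).1)).
Proof. by move=> /(_ n) [lt <-]; rewrite subst_iterS (iter_subst_split _ _ l lt). Qed.

Hypothesis sP : proper_subst s l r.

Lemma path_pos_lt x n : valid_path x -> path_pos x n < size (W n (path_letter x n)).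
Proof.
move=> vx; elim: n => [//|n IH]; rewrite path_split // !size_cat ltn_add2l.
exact: ltn_addr.
Qed.

Lemma nth_path_pos x n : valid_path x ->
  nth l (W n (path_letter x n)) (path_pos x n) = path_letter x 0.
Proof.
move=> vx; elim: n => [//|n <-]; rewrite path_split // nth_cat ltnNge leq_addr /=.
by rewrite addKn nth_cat path_pos_lt.
Qed.

(** The wider window consists of blocks of level [n.+1]. Those left of the central one form
    [I n.+1 (r :: u)], which ends with [W n r]; those right of it form [I n.+1 (rcons v l)], which
    begins with [W n l]. *)
Lemma path_windowS x n : valid_path x -> exists p q,
  path_window x n.+1 = p ++ path_window x n ++ q /\
  path_base x n.+1 = size p + path_base x n.
Proof.
move=> vx; rewrite /path_window (path_split n.+1) //.
set u := take _ _; set v := drop _ _.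
have [p pE] := @iter_proper_suffix _ _ _ _ sP n (r :: u) isT.
have [q qE] := @iter_proper_prefix _ _ _ _ sP n (rcons v l) ltac:(by case: v).
rewrite iter_subst_cons in pE; rewrite iter_subst_rcons in qE.
exists p, q; split.
  by rewrite -!catA qE catA pE -!catA.
move/(congr1 size): pE; rewrite !size_cat /path_base /= -/u; lia.
Qed.

Lemma path_window_le x n m : valid_path x -> n <= m -> exists p q,
  path_window x m = p ++ path_window x n ++ q /\
  path_base x m = size p + path_base x n.
Proof.
move=> vx /subnK <-; elim: (m - n) => [|k [p [q [E1 E2]]]].
  by exists [::], [::]; rewrite cats0.
have [p' [q' [E3 E4]]] := path_windowS (k + n) vx.
exists (p' ++ p), (q ++ q'); rewrite addSn E3 E4 E1 E2 size_cat -!catA; split=> //.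
lia.
Qed.

Lemma path_base_gt x n : n < path_base x n.
Proof. by apply: leq_trans (ltn_size_subst_iter sP n r) _; exact: leq_addr. Qed.

Lemma path_base_lt x n : valid_path x -> path_base x n + n < size (path_window x n).
Proof.
move=> vx; rewrite /path_window /path_base !size_cat.
by have := path_pos_lt n.+1 vx; have := ltn_size_subst_iter sP n l; lia.
Qed.

Lemma path_pointE x n j : valid_path x -> j < size (path_window x n) ->
  path_point x (j%:Z - (path_base x n)%:Z)%R = nth l (path_window x n) j.
Proof.
move=> vx lj; rewrite /path_point; set i := (_ - _)%R.
have b1 := path_base_gt x `|i|; have b2 := path_base_lt `|i| vx.
have [le|/ltnW le] := leqP n `|i|.
  have [p [q [E1 E2]]] := path_window_le vx le.
  rewrite E1 E2; have -> : `|((size p + path_base x n)%:Z + i)%R| = size p + j by rewrite /i; lia.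
  by rewrite nth_cat ltnNge leq_addr /= addKn nth_cat lj.
have [p [q [E1 E2]]] := path_window_le vx le.
rewrite E1.
have E3 : j = size p + `|((path_base x `|i|)%:Z + i)%R| by rewrite {2}/i; lia.
rewrite [in RHS]E3 nth_cat ltnNge leq_addr /= addKn nth_cat ifT //.
by move: b1 b2; lia.
Qed.

Lemma path_pointW x n j : valid_path x -> j < size (W n (path_letter x n)) ->
  path_point x (j%:Z - (path_pos x n)%:Z)%R = nth l (W n (path_letter x n)) j.
Proof.
move=> vx lj; set u := I n (take (x n).2 (s (x n).1)).
have -> : (j%:Z - (path_pos x n)%:Z = (size (W n r) + size u + j)%:Z - (path_base x n)%:Z)%R.
  by rewrite /path_base /= -/u; lia.
have E := path_split n vx.
have lt : size (W n r) + size u + j < size (path_window x n).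
  by rewrite /path_window E !size_cat -/u; move: lj; lia.
rewrite path_pointE // /path_window E -/u.
rewrite -addnA nth_cat ltnNge leq_addr /= addKn -!catA.
by rewrite nth_cat ltnNge leq_addr /= addKn nth_cat lj.
Qed.

Lemma path_point0 x : valid_path x -> path_point x 0%R = path_letter x 0.
Proof. by move=> vx; have := @path_pointW x 0 0 vx isT. Qed.

Lemma path_point_window x n i k : valid_path x ->
  (- (path_base x n)%:Z <= i)%R ->
    (i + k%:Z <= (size (path_window x n))%:Z - (path_base x n)%:Z)%R ->
  subword (path_point x) i k =
  take k (drop `|(i + (path_base x n)%:Z)%R| (path_window x n)).
Proof.
move=> vx lo hi; set o := `|_|.
have oE : (i = o%:Z - (path_base x n)%:Z)%R by rewrite /o; lia.
have ok : o + k <= size (path_window x n) by rewrite /o; lia.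
apply: (@eq_from_nth _ l).
  by rewrite size_map size_iota size_takel // size_drop; lia.
rewrite size_map size_iota => j lj.
rewrite (nth_map 0) ?size_iota // nth_iota // add0n nth_take // nth_drop oE.
rewrite -path_pointE //; last by lia.
congr path_point; lia.
Qed.

Lemma language_path_window x n : language s (path_window x n).
Proof. exact: language_context. Qed.

Lemma language_path_point x i k : valid_path x -> language s (subword (path_point x) i k).
Proof.
move=> vx; pose n := `|i| + k.
have b1 := path_base_gt x n; have b2 := path_base_lt n vx.
rewrite (@path_point_window x n) //; [|by lia|by lia].
apply: language_infix (language_path_window x n).
by apply: infix_trans (infix_take _ _) (infix_drop _ _).
Qed.

Lemma path_pos_tail x y n m : (forall k, n <= k -> x k = y k) -> n <= m ->
  ((path_pos y m)%:Z - (path_pos x m)%:Z = (path_pos y n)%:Z - (path_pos x n)%:Z)%R.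
Proof.
by move=> xy /subnK <-; elim: (m - n) => //= k IH; rewrite xy ?leq_addl //; lia.
Qed.

(** Cofinal paths lie on one orbit: from level [n] on, their positions in the common blocks differ
    by a constant, which is the shift. *)
Lemma path_point_tail x y n i : valid_path x -> valid_path y ->
  (forall m, n <= m -> x m = y m) ->
  path_point y i = path_point x (i + ((path_pos y n)%:Z - (path_pos x n)%:Z))%R.
Proof.
move=> vx vy xy.
have pE m := @path_pos_tail x y n m xy.
pose m := maxn n `|i|.
have nm : n <= m by exact: leq_maxl.
have im : `|i| <= m by exact: leq_maxr.
have WE : path_window x m = path_window y m by rewrite /path_window /= xy.
have b1 := path_base_gt y m; have b2 := path_base_lt m vy.
have -> : (i = `|(i + (path_base y m)%:Z)%R|%:Z - (path_base y m)%:Z)%R by lia.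
rewrite path_pointE //; last by lia.
rewrite -WE -path_pointE //; last by rewrite WE; lia.
congr path_point; rewrite -(pE m.+1) ?(leq_trans nm) //.
by rewrite /path_base; lia.
Qed.

(** Going down from level [n], the block and the position in it determine the next smaller block and
    the position there, that is, the edge. *)
Lemma path_pos_inj x y n : valid_path x -> valid_path y ->
  path_letter x n = path_letter y n -> path_pos x n = path_pos y n ->
  forall m, m < n -> x m = y m.
Proof.
move=> vx vy; elim: n => // n IH E1 E2.
have := vx n; have := vy n; have px := path_pos_lt n vx; have py := path_pos_lt n vy.
move: E1 E2 => /=; case Ex: (x n) => [a k]; case Ey: (y n) => [b k'] /= ab;
  subst b => E [lk' nk'] [lk nk].
rewrite -nk in px; rewrite -nk' in py.
have [kk pp] := iter_subst_offset_inj lk lk' px py E.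
move=> m; rewrite ltnS leq_eqVlt => /orP [/eqP ->|]; first by rewrite Ex Ey kk.
by apply: IH; rewrite // -nk -nk' kk.
Qed.

Lemma valid_path_cons e x : valid_path x -> e.2 < size (s e.1) -> path_letter x 0 = e.1 ->
  valid_path (path_cons e x).
Proof.
move=> vx le xe [|n]; first by [].
by have [lt E] := vx n; split=> //; rewrite E; case: n {lt E}.
Qed.

Lemma path_letter_cons e x n : path_letter x 0 = e.1 ->
  path_letter (path_cons e x) n.+1 = path_letter x n.
Proof. by case: n. Qed.

Lemma path_letter_shift N x n : valid_path x ->
  path_letter (path_shift N x) n = path_letter x (N + n).
Proof.
move=> vx; case: n => [|n]; last by rewrite addnS.
by rewrite /= /path_shift addn0; have [] := vx N.
Qed.

Lemma valid_path_shift N x : valid_path x -> valid_path (path_shift N x).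
Proof.
move=> vx n; rewrite path_letter_shift //; exact: vx.
Qed.

(** The position of the shifted path counts the blocks of level [N] before the one with the base
    point; [I N] turns this count into a length. *)
Lemma path_posD N n x : valid_path x ->
  path_pos x (N + n) = path_pos x N +
    size (I N (take (path_pos (path_shift N x) n) (W n (path_letter x (N + n))))).
Proof.
move=> vx; elim: n => [|n IH]; first by rewrite addn0 take0 iter_subst_nil addn0.
have vs := valid_path_shift N vx.
have := path_split n vs; rewrite !path_letter_shift // => ->.
rewrite addnS /= IH /path_shift take_cat ltnNge leq_addr /= addKn.
rewrite iter_subst_cat size_cat -iterD takel_cat ?(leq_trans (ltnW (path_pos_lt n vs)))
  ?path_letter_shift //.
by rewrite -/(path_shift N x); lia.
Qed.

Lemma valid_path_min x : valid_path x -> valid_path (path_min x).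
Proof.
by move=> vx; apply: valid_path_cons => //=; apply: ltn_trans (proper_size sP _).
Qed.

Lemma iter_path_minE N x n : iter N path_min x (N + n) = x n.
Proof. by elim: N => //= N IH; rewrite addSn. Qed.

Lemma valid_iter_path_min N x : valid_path x -> valid_path (iter N path_min x).
Proof. by move=> vx; elim: N => //= N /valid_path_min. Qed.

Lemma path_letter_iter_min N x n : path_letter (iter N path_min x) (N + n) = path_letter x n.
Proof. by elim: N n => [//|N IH] n; rewrite addSn iterS path_letter_cons. Qed.

Lemma iter_path_min_rank N x n : n < N -> (iter N path_min x n).2 = 0.
Proof. by elim: N n => //= N IH [|n] //= /IH. Qed.

Lemma path_pos_iter_min N x : path_pos (iter N path_min x) N = 0.
Proof.
suff H n : n <= N -> path_pos (iter N path_min x) n = 0 by exact: H.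
by elim: n => //= n IH lt; rewrite iter_path_min_rank // take0 iter_subst_nil IH // ltnW.
Qed.

Lemma path_shift_iter_min N x : path_shift N (iter N path_min x) = x.
Proof. by apply/funext => n; rewrite /path_shift iter_path_minE. Qed.

Lemma path_pos_iter_minD N n x : valid_path x -> path_pos (iter N path_min x) (N + n) =
  size (I N (take (path_pos x n) (W n (path_letter x n)))).
Proof.
move=> vx; rewrite path_posD ?path_pos_iter_min ?path_shift_iter_min ?path_letter_iter_min //.
exact: valid_iter_path_min.
Qed.

(** The edges below [n] are rebuilt downwards from the coordinates of [q]. Validity is asked from
    [n] on only, so that the induction can replace one edge before the lower ones are known. *)
Lemma path_splice n q x : q < size (W n (nth l (s (x n).1) (x n).2)) ->
  (x n).2 < size (s (x n).1) ->
  (forall m, n <= m -> (x m.+1).2 < size (s (x m.+1).1) /\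
                       nth l (s (x m.+1).1) (x m.+1).2 = (x m).1) ->
  exists y, [/\ valid_path y, forall m, n <= m -> y m = x m & path_pos y n = q].
Proof.
elim: n q x => [|n IH] q x lq lx vx.
  exists x; split=> //; last by case: q lq.
  by case=> [|m]; [split | exact: vx].
move: lq; rewrite subst_iterS; set c := nth _ _ _ => /(iter_subst_offset l) [k [p [lk lp qE]]].
pose x' m := if m == n then (c, k) else x m.
have x'E m : n < m -> x' m = x m by rewrite /x'; case: eqP => // ->; rewrite ltnn.
have x'n : x' n = (c, k) by rewrite /x' eqxx.
have [|||y [vy yx py]] := IH p x'; rewrite ?x'n //.
  move=> m; rewrite leq_eqVlt => /orP [/eqP <-|lt].
    by rewrite x'n x'E.
  by rewrite !x'E ?ltnS ?(ltnW lt) //; exact: vx.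
exists y; split=> //.
  by move=> m lt; rewrite yx ?x'E // ltnW.
by rewrite /= yx // x'n py -qE.
Qed.

Lemma path_through n a q : q < size (W n a) -> exists y,
  [/\ valid_path y, path_letter y n = a & path_pos y n = q].
Proof.
move=> lq; have aa := proper_mem sP a a.
(* A constant tail is possible since [a] occurs in [s a]. *)
have [||m _|y [vy yE yq]] := @path_splice n q (fun=> (a, index a (s a)));
  rewrite /= ?nth_index ?index_mem //.
by exists y; split=> //; have [_ <-] := vy n; rewrite yE //= nth_index.
Qed.

Lemma word_in_path_point v i : language s v -> i < size v -> exists2 x, valid_path x &
  forall j, j < size v -> path_point x (j%:Z - i%:Z)%R = nth l v j.
Proof.
move=> [n [a /infixP [p [q E]]]] lti.
have lt j : j < size v -> size p + j < size (W n a).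
  by move=> ltj; rewrite E !size_cat ltn_add2l ltn_addr.
have [x [vx xa px]] := path_through (lt i lti).
exists x => // j ltj.
have -> : (j%:Z - i%:Z = (size p + j)%:Z - (path_pos x n)%:Z)%R by rewrite px; lia.
rewrite path_pointW ?xa ?lt // E.
by rewrite nth_cat ltnNge leq_addr /= addKn nth_cat ltj.
Qed.

End Paths.

(** * Compactness of the space of paths *)

Lemma konig (E : eqType) (S : seq E) (x : nat -> nat -> E) :
  (forall N i, x N i \in S) ->
  exists y, forall n M, exists2 N, M <= N & forall i, i < n -> x N i = y i.
Proof.
move=> xS.
(* [p] begins [x N] for arbitrarily large [N]; by pigeonhole some extension by one entry has the
   same property. *)
pose inf p := forall M, exists2 N, M <= N & mkseq (x N) (size p) = p.
have step p : exists e, inf p -> inf (rcons p e).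
  have [infp|] := EM (inf p); last by exists (x 0 0).
  have [[e He]|no] := EM (exists e, inf (rcons p e)); first by exists e.
  have /choice [f fP] : forall e, exists M, forall N, M <= N ->
    mkseq (x N) (size p).+1 <> rcons p e.
    move=> e; have [//|ne] := EM (exists M, forall N, M <= N ->
      mkseq (x N) (size p).+1 <> rcons p e).
    case: no; exists e => M; rewrite size_rcons.
    have [//|ne'] := EM (exists2 N, M <= N & mkseq (x N) (size p).+1 = rcons p e).
    by case: ne; exists M => N MN EN; apply: ne'; exists N.
  have [N leN EN] := infp (\max_(e <- S) f e).
  case: (fP (x N (size p)) N); last by rewrite mkseqS EN.
  by apply: leq_trans leN; apply: leq_bigmax_seq.
have [f fP] := choice step.
pose w n := iter n (fun p => rcons p (f p)) [::].
have sw n : size (w n) = n by elim: n => //= n IH; rewrite size_rcons IH.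
have infw n : inf (w n) by elim: n => [M|n IH]; [exists M | exact: fP].
have wE n : w n = mkseq (fun i => f (w i)) n by elim: n => //= n IH; rewrite mkseqS -IH.
exists (fun i => f (w i)) => n M.
have [N leN EN] := infw n M; exists N => // i lt.
by move: EN; rewrite sw wE => /(congr1 (nth (x 0 0) ^~ i)); rewrite !nth_mkseq.
Qed.

Section Compactness.
Variables (A : finType) (s : A -> seq A) (l r : A).
Hypothesis sP : proper_subst s l r.

Notation I n := (iter n (subst_word s)).
Notation W := (subst_iter s).
Notation valid := (valid_path s l).
Notation pt := (path_point s l r).

Lemma path_pos_local x y n : (forall m, m < n -> x m = y m) -> path_pos s x n = path_pos s y n.
Proof.
by elim: n => //= n IH xy; rewrite xy // IH // => m lt; apply: xy; exact: ltnW.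
Qed.

Lemma path_point_local x y i : (forall m, m <= `|i| -> x m = y m) -> pt x i = pt y i.
Proof.
move=> xy; have pE := @path_pos_local x y `|i|.+1 xy.
by rewrite /path_point /path_base pE /path_window /= xy.
Qed.

Lemma valid_path_local x : (forall m, exists2 y, valid y & forall i, i < m -> y i = x i) ->
  valid x.
Proof.
move=> H m; have [y vy yx] := H m.+2.
have := vy m; rewrite -yx //.
case: m yx => [|m] yx; first by rewrite /= -yx.
by rewrite /= -[x m]yx //; lia.
Qed.

Lemma valid_path_compact (x : nat -> nat -> A * nat) : (forall N, valid (x N)) ->
  exists2 y, valid y & forall n M, exists2 N, M <= N & forall i, i < n -> x N i = y i.
Proof.
move=> vx.
have [N i|y yP] := @konig _ [seq (a, k) | a <- enum A, k <- iota 0 (max_size s)] x.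
  have [lt _] := vx N i; case: (x N i) lt => a k /= lt.
  apply/allpairsP; exists (a, k); rewrite mem_enum mem_iota /= add0n; split=> //.
  by apply: leq_trans lt _; exact: (@leq_bigmax _ (fun a => size (s a))).
exists y => //; apply: valid_path_local => m.
by have [N _ xy] := yP m 0; exists (x N).
Qed.

(** Every central word of [z] is coded by a path, and a limit of these paths codes [z], since each
    coordinate depends on finitely many edges. *)
Lemma path_point_surj (z : int -> A) : (forall i k, language s (subword z i k)) ->
  exists2 x, valid x & pt x = z.
Proof.
move=> Lz.
have /choice [x xP] : forall N : nat, exists x, valid x /\
    forall i : int, (`|i| <= N)%N -> pt x i = z i.
  move=> N; have [||x vx xE] := @word_in_path_point _ s l r sP (subword z (- N%:Z)%R (N + N).+1) N.
  - exact: Lz.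
  - by rewrite size_map size_iota; lia.
  exists x; split=> // i iN.
  have := xE `|(i + N%:Z)%R|; rewrite size_map size_iota.
  have -> : (`|(i + N%:Z)%R|%:Z - N%:Z)%R = i by lia.
  rewrite (nth_map 0) ?size_iota ?nth_iota; try lia.
  move=> ->; last by lia.
  by congr z; lia.
have [N|y vy yP] := @valid_path_compact x; first by have [] := xP N.
exists y => //; apply/funext => i.
have [N iN xy] := yP `|i|.+1 `|i|.
by have [_ <- //] := xP N; apply/esym/path_point_local.
Qed.

(** This is continuity of the inverse coding. Otherwise, paths that differ from [x] among the first
    [n] edges, with points converging to that of [x], would accumulate at a second path with the
    same point. *)
Lemma path_local x : (forall y, valid y -> pt y = pt x -> y = x) -> forall n,
  exists N : nat, forall y, valid y -> (forall i : int, (`|i| <= N)%N -> pt y i = pt x i) ->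
  forall m, m < n -> y m = x m.
Proof.
move=> inj n.
have [//|no] := EM (exists N : nat, forall y, valid y ->
  (forall i : int, (`|i| <= N)%N -> pt y i = pt x i) -> forall m, m < n -> y m = x m).
have /choice [y yP] : forall N : nat, exists y, [/\ valid y,
    forall i : int, (`|i| <= N)%N -> pt y i = pt x i & ~ forall m, m < n -> y m = x m].
  move=> N; have [//|ne] := EM (exists y, [/\ valid y,
    forall i : int, (`|i| <= N)%N -> pt y i = pt x i & ~ forall m, m < n -> y m = x m]).
  case: no; exists N => y vy yE; have [//|ne'] := EM (forall m, m < n -> y m = x m).
  by case: ne; exists y.
have [N|z vz zP] := @valid_path_compact y; first by have [] := yP N.
have zx : z = x.
  apply: inj => //; apply/funext => i; have [N iN yz] := zP `|i|.+1 `|i|.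
  have [_ <- // _] := yP N; by apply/esym/path_point_local.
have [N _ yz] := zP n 0; have [_ _] := yP N.
by case=> m lt; rewrite yz // zx.
Qed.

Lemma leq_size_subst_word w : size w <= size (subst_word s w).
Proof.
elim: w => // a w IH; rewrite /subst_word /= size_cat -add1n leq_add //.
by apply: leq_trans (proper_size sP a).
Qed.

Lemma path_window_center x n : valid x -> exists p q,
  path_window s l r x n = p ++ subword (pt x) (- n%:Z)%R n ++ subword (pt x) 0%R n ++ q /\
  size p + n = path_base s r x n.
Proof.
move=> vx; have b1 := path_base_gt sP x n; have b2 := path_base_lt sP n vx.
rewrite !(@path_point_window _ s l r sP x n) //; try lia.
set V := path_window _ _ _ _ _; set b := path_base _ _ _ _.
have -> : `|(- n%:Z + b%:Z)%R| = b - n by rewrite /b; lia.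
have -> : `|(0 + b%:Z)%R| = b by lia.
exists (take (b - n) V), (drop n (drop b V)); split; last by rewrite size_takel /b /V; lia.
rewrite cat_take_drop.
have -> : drop b V = drop n (drop (b - n) V) by rewrite drop_drop subnKC // /b; lia.
by rewrite !cat_take_drop.
Qed.

Lemma path_pos_cons e x n : valid x -> e.2 < size (s e.1) -> path_letter s l x 0 = e.1 ->
  path_pos s (path_cons e x) n.+1 =
  e.2 + size (subst_word s (take (path_pos s x n) (W n (path_letter s l x n)))).
Proof.
move=> vx le xe; have vc := valid_path_cons vx le xe.
rewrite -(path_letter_cons n xe) -add1n (path_posD 1 n vc).
by congr (_ + _); rewrite /= addn0 size_takel // ltnW.
Qed.

Lemma path_point_cons_window e x n j : valid x -> e.2 < size (s e.1) -> path_letter s l x 0 = e.1 ->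
  let u := subst_word s (subword (pt x) (- n%:Z)%R n) in
  let v := subst_word s (subword (pt x) 0%R n) in
  j < size (u ++ v) -> pt (path_cons e x) (j%:Z - (size u)%:Z - e.2%:Z)%R = nth l (u ++ v) j.
Proof.
move=> vx le xe u v lj.
have vc := valid_path_cons vx le xe.
have [p [q [E1 E2]]] := path_window_center n vx.
have VE : path_window s l r (path_cons e x) n.+1 = subst_word s (path_window s l r x n).
  by rewrite /path_window !subst_word_cat.
have bE : path_base s r (path_cons e x) n.+1 = size (subst_word s p) + size u + e.2.
  rewrite -size_cat -subst_word_cat; set w := p ++ _.
  have -> : w = W n r ++ take (path_pos s x n.+1) (W n.+1 (path_letter s l x n.+1)).
    have -> : w = take (path_base s r x n) (path_window s l r x n).
      by rewrite E1 catA take_size_cat // -/w size_cat size_map size_iota.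
    have tE (u1 u2 : seq A) k : take (size u1 + k) (u1 ++ u2) = u1 ++ take k u2.
      by rewrite take_cat ltnNge leq_addr /= addKn.
    by rewrite /path_window /path_base tE takel_cat // ltnW // path_pos_lt.
  rewrite subst_word_cat size_cat /path_base path_pos_cons //.
  by rewrite -[W n.+1 r]/(subst_word s (W n r)); lia.
have lt : size (subst_word s p) + j < size (path_window s l r (path_cons e x) n.+1).
  rewrite VE E1 !subst_word_cat.
  by move: lj; rewrite !size_cat -/u -/v; lia.
have := path_pointE sP vc lt; rewrite bE.
rewrite VE E1 !subst_word_cat nth_cat ltnNge leq_addr /= addKn catA nth_cat lj => <-.
by congr pt; lia.
Qed.

Lemma path_point_cons e x y : valid x -> valid y -> e.2 < size (s e.1) ->
  path_letter s l x 0 = e.1 -> pt x = pt y -> pt (path_cons e x) = pt (path_cons e y).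
Proof.
move=> vx vy le xe xy; apply/funext => i.
have ye : path_letter s l y 0 = e.1 by rewrite -xe -!(path_point0 sP) // xy.
pose n := `|i| + e.2.+1.
have := @path_point_cons_window e x n `|(i + (size (subst_word s (subword (pt x) (- n%:Z)%R
  n)))%:Z + e.2%:Z)%R| vx le xe.
have := @path_point_cons_window e y n `|(i + (size (subst_word s (subword (pt y) (- n%:Z)%R
  n)))%:Z + e.2%:Z)%R| vy le ye.
rewrite /= -xy; set u := subst_word _ _; set v := subst_word _ _.
have lu : n <= size u.
  by apply: leq_trans (leq_size_subst_word _); rewrite size_map size_iota.
have lv : n <= size v.
  by apply: leq_trans (leq_size_subst_word _); rewrite size_map size_iota.
set j := `|_|.
have lj : j < size (u ++ v) by rewrite size_cat /j /n in lu lv *; lia.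
have jE : (j%:Z - (size u)%:Z - e.2%:Z)%R = i by rewrite /j /n in lu *; lia.
by rewrite jE => /(_ lj) -> /(_ lj) ->.
Qed.

Lemma path_point_iter_min N x y : valid x -> valid y -> pt x = pt y ->
  pt (iter N (path_min s l) x) = pt (iter N (path_min s l) y).
Proof.
move=> vx vy xy; elim: N => // N IH; rewrite !iterS.
set x' := iter N _ x in IH *; set y' := iter N _ y in IH *.
have vx' : valid x' by exact: valid_iter_path_min.
have vy' : valid y' by exact: valid_iter_path_min.
rewrite /path_min -(path_point0 sP vy') -IH (path_point0 sP vx').
by apply: path_point_cons => //=; apply: ltn_trans (proper_size sP _).
Qed.

End Compactness.

(** * Recognizability *)

Section Recognizability.
Variables (A : finType) (s : A -> seq A) (l r : A).
Hypothesis sP : proper_subst s l r.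

Notation I n := (iter n (subst_word s)).
Notation W := (subst_iter s).
Notation valid := (valid_path s l).
Notation pt := (path_point s l r).
Notation lev := (path_letter s l).
Notation pos := (path_pos s).
Notation mins N := (iter N (path_min s l)).

(** [u] is a piece of the point of [x] that contains its block of level [D], with the base point at
    index [B]; [I N] maps it to a piece of the point of [mins N x]. The position [q] then falls into
    the image of letter [k] of [u], and the last equation computes its place in [I N u] both from
    this letter and from the base point. *)
Lemma splice_below x N D q u B : valid x -> q < size (W (N + D) (lev x D)) ->
  pos x D <= B -> B + size (W D (lev x D)) <= size u ->
  (forall k, k < size u -> nth l u k = pt x (k%:Z - B%:Z)%R) ->
  exists y k, [/\ valid y, path_pos s y (N + D) = q, lev y (N + D) = lev x D,
    k < size u /\ nth l u k = lev y N &
    pos y N + size (I N (take k u)) + pos (mins N x) (N + D) = q + size (I N (take B u))].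
Proof.
move=> vx lq lB lu uE.
have vm := valid_iter_path_min sP N vx.
have [||m lm|y [vy yx yq]] := @path_splice A s l (N + D) q (mins N x).
- by have [_ ->] := vm (N + D); rewrite path_letter_iter_min.
- by have [] := vm (N + D).
- exact: (vm m.+1).
have yl : lev y (N + D) = lev x D.
  by have [_ <-] := vy (N + D); rewrite yx //; have [_ ->] := vm (N + D);
    rewrite path_letter_iter_min.
pose z := path_shift N y; have vz : valid z by exact: valid_path_shift.
have zl : lev z D = lev x D by rewrite path_letter_shift.
have ltz : pos z D < size (W D (lev x D)) by rewrite -zl path_pos_lt.
pose o := B - pos x D.
have oE : take (size (W D (lev x D))) (drop o u) = W D (lev x D).
  apply: (@eq_from_nth _ l); first by rewrite size_takel // size_drop /o; lia.
  rewrite size_takel ?size_drop; last by rewrite /o; lia.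
  move=> i li; rewrite nth_take // nth_drop uE; last by rewrite /o; lia.
  by rewrite -(path_pointW sP vx li); congr pt; rewrite /o; lia.
have tE p : p <= size (W D (lev x D)) ->
    size (I N (take (o + p) u)) = size (I N (take o u)) + size (I N (take p (W D (lev x D)))).
  by move=> lp; rewrite takeD iter_subst_cat size_cat -[in RHS]oE take_takel.
have ltx : pos x D < size (W D (lev x D)) by rewrite path_pos_lt.
exists y, (o + pos z D); split=> //.
  split; first by rewrite /o; lia.
  rewrite -nth_drop -(nth_take _ ltz) oE -zl nth_path_pos //.
  by rewrite path_letter_shift // addn0.
rewrite -yq (path_posD N D vy) yl (path_pos_iter_minD sP N D vx).
rewrite tE; last exact: ltnW.
have -> : B = o + pos x D by rewrite /o; lia.
by rewrite tE -/z; [lia | exact: ltnW].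
Qed.

(* Two distinct paths with the same point, preceded by [i] and by [i'] minimal
   edges, give pairs that separate at different depths. The overlap of the two
   words of level [j] around the base point fixes the depth of separation. *)
Lemma overlap_determines_depth x y e i i' j : valid x -> valid y -> pt x = pt y ->
  x e <> y e -> i + e < i' -> i' <= j ->
  lev (mins i x) j = lev (mins i' x) j -> lev (mins i y) j = lev (mins i' y) j ->
  pos (mins i x) j + pos (mins i' y) j = pos (mins i' x) j + pos (mins i y) j -> False.
Proof.
move=> vx vy xy xye ii' i'j; rewrite -(subnKC i'j); set D := j - i'.
rewrite !(path_letter_iter_min _ _ i').
move=> lx ly E.
(* [u] is made long enough to contain the blocks of level [D] of both paths. *)
pose B := pos x D + pos y D.
pose K := B + size (W D (lev x D)) + size (W D (lev y D)).
pose u := subword (pt x) (- B%:Z)%R K.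
have su : size u = K by rewrite size_map size_iota.
have uE k : k < size u -> nth l u k = pt x (k%:Z - B%:Z)%R.
  rewrite su => lk; rewrite (nth_map 0) ?size_iota // nth_iota // add0n.
  by congr pt; lia.
have vix := valid_iter_path_min sP i vx; have viy := valid_iter_path_min sP i vy.
(* The block of level [i' + D] is kept, but the position in it is taken from [mins i x]; the same is
   done for [y]. By the assumption on the overlap both positions are one place in [I i' u], so [x']
   and [y'] agree below level [i']. *)
have [|||x' [k [vx' qx lx' [lk kx] Ex]]] :=
  @splice_below x i' D (pos (mins i x) (i' + D)) u B vx _ _ _ uE.
- by rewrite -lx path_pos_lt.
- exact: leq_addr.
- by rewrite su /K; lia.
rewrite xy in uE.
have [|||y' [k' [vy' qy ly' [lk' ky] Ey]]] :=
  @splice_below y i' D (pos (mins i y) (i' + D)) u B vy _ _ _ uE.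
- by rewrite -ly path_pos_lt.
- exact: leq_addl.
- by rewrite su /K; lia.
have px := path_pos_lt i' vx'; have py := path_pos_lt i' vy'.
rewrite -kx in px; rewrite -ky in py.
have [kk pp] := iter_subst_offset_inj lk lk' px py ltac:(lia).
have x'y' := path_pos_inj vx' vy' _ pp.
have {}x'y' : x' (i + e) = y' (i + e) by apply: x'y'; rewrite -?kx -?ky ?kk.
have iD : i + e < i' + D by lia.
(* Below level [i' + D], [x'] and [y'] coincide with [mins i x] and [mins i y], whose edges of index
   [i + e] are [x e] and [y e]. *)
have x'x := path_pos_inj vx' vix _ qx.
have y'y := path_pos_inj vy' viy _ qy.
apply: xye; rewrite -(iter_path_minE s l i x e) -(iter_path_minE s l i y e).
by rewrite -x'x -?y'y // ?lx ?ly ?lx' ?ly'.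
Qed.

(** The block of [y] begins with [W j l]. Read in the window of [x], this is an occurrence of
    [W j l] whose distance from the start of the block of [x] is the difference of the positions. *)
Lemma overlap_prefix x y j p : valid x -> valid y -> pt x = pt y ->
  pos y j.+1 <= pos x j.+1 -> p < size (W j l) ->
  nth l (W j.+1 (lev x j.+1) ++ W j l) (pos x j.+1 - pos y j.+1 + p) = nth l (W j l) p.
Proof.
move=> vx vy xy le lp.
have ltx := path_pos_lt j.+1 vx.
set k := _ + p.
have lk : k < size (W j.+1 (lev x j.+1) ++ W j l) by rewrite size_cat /k; lia.
have lk' : size (W j r) + k < size (path_window s l r x j).
  by rewrite /path_window size_cat ltn_add2l.
have := path_pointE sP vx lk'; rewrite /path_window nth_cat ltnNge leq_addr /= addKn => <-.
have [w wE] := proper_prefix sP j (lev y j.+1).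
have lp' : p < size (W j.+1 (lev y j.+1)) by rewrite wE size_cat ltn_addr.
have := path_pointW sP vy lp'; rewrite wE nth_cat lp => <-.
rewrite xy; congr pt; rewrite /path_base /k; lia.
Qed.

Variable Q : nat.
Hypothesis QP : forall v d, language s v -> 0 < d -> has_period l d v -> size v < Q * d.

(** Two occurrences of [W j l] at a distance [d > 0] with [Q * d < size (W j l)] would give this
    word the period [d], against the choice of [Q]. So a bucket of length [size (W j l) / Q]
    contains one occurrence at most. *)
Lemma overlap_bucket x y x' y' j : valid x -> valid y -> pt x = pt y ->
  valid x' -> valid y' -> pt x' = pt y' -> lev x j.+1 = lev x' j.+1 ->
  pos y j.+1 <= pos x j.+1 -> pos y' j.+1 <= pos x' j.+1 ->
  (pos x j.+1 - pos y j.+1) * Q %/ size (W j l) =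
  (pos x' j.+1 - pos y' j.+1) * Q %/ size (W j l) ->
  pos x j.+1 - pos y j.+1 = pos x' j.+1 - pos y' j.+1.
Proof.
move=> vx vy xy vx' vy' xy' E le le' bE.
set t := pos x _ - _ in bE *; set t' := pos x' _ - _ in bE *.
have W0 : 0 < size (W j l) by apply: leq_ltn_trans (ltn_size_subst_iter sP j l).
have key t1 t2 : t1 < t2 -> t1 * Q %/ size (W j l) = t2 * Q %/ size (W j l) ->
    (forall p, p < size (W j l) ->
      nth l (W j.+1 (lev x j.+1) ++ W j l) (t1 + p) = nth l (W j l) p) ->
    (forall p, p < size (W j l) ->
      nth l (W j.+1 (lev x j.+1) ++ W j l) (t2 + p) = nth l (W j l) p) -> False.
  move=> lt tE H1 H2.
  have := @QP (W j l) (t2 - t1); rewrite subn_gt0 lt.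
  move=> /(_ _ isT) H; suff : size (W j l) < Q * (t2 - t1).
    have := divn_eq (t1 * Q) (size (W j l)); have := divn_eq (t2 * Q) (size (W j l)).
    rewrite tE; have := ltn_pmod (t1 * Q) W0; have := ltn_pmod (t2 * Q) W0.
    by move: (_ %% _) (_ %% _) (_ %/ _ * _) => a b c; nia.
  apply: H => [|i li]; first by exists j, l; exact: infix_refl.
  rewrite -H2 -?H1 //; last by lia.
  by congr nth; lia.
have O1 p : p < size (W j l) ->
    nth l (W j.+1 (lev x j.+1) ++ W j l) (t + p) = nth l (W j l) p.
  exact: overlap_prefix.
have O2 p : p < size (W j l) ->
    nth l (W j.+1 (lev x j.+1) ++ W j l) (t' + p) = nth l (W j l) p.
  by rewrite E; exact: overlap_prefix.
by have [lt|lt|//] := ltngtP t t'; [have := key t t' | have := key t' t]; case/(_ lt).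
Qed.

Lemma leq_size_subst_iterS j a b : size (W j.+1 a) <= max_size s ^ 2 * size (W j b).
Proof.
rewrite subst_iterS; apply: (@leq_trans (size (s a) * (max_size s * size (W j b)))).
  elim: (s a) => [|c w IH]; first by rewrite iter_subst_nil.
  by rewrite iter_subst_cons size_cat mulSn leq_add // (leq_size_subst_iter sP).
by rewrite expnS expn1 -mulnA leq_mul2r (@leq_bigmax _ (fun a => size (s a))) orbT.
Qed.

Theorem path_point_inj x y : valid x -> valid y -> pt x = pt y -> x = y.
Proof.
move=> vx vy xy; apply/funext => e; have [//|xye] := EM (x e = y e); exfalso.
(* The overlap [t i] is at most the length of a block of level [j.+1], which is at most
   [max_size s ^ 2 * size (W j l)]; this leaves [K.+1] buckets for every [j]. *)
pose K := max_size s ^ 2 * Q.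
pose J := #|{: bool * A * A * 'I_K.+1}|.
(* [j] exceeds all the numbers of prepended edges used below; these are multiples of [e.+1], so two
   of them differ by more than [e]. *)
have [j jE] : exists j, j = J.+1 * e.+1 by exists (J.+1 * e.+1).
pose X (i : 'I_J.+1) := mins (i * e.+1) x.
pose Y (i : 'I_J.+1) := mins (i * e.+1) y.
pose t i := maxn (pos (X i) j.+1) (pos (Y i) j.+1) - minn (pos (X i) j.+1) (pos (Y i) j.+1).
(* Which block starts first, the letters of both blocks, and the bucket of the overlap; two of the
   [J.+1] indices agree in all of these. *)
pose f i : bool * A * A * 'I_K.+1 := (pos (Y i) j.+1 <= pos (X i) j.+1, lev (X i) j.+1,
  lev (Y i) j.+1, inord (t i * Q %/ size (W j l))).
have vX i : valid (X i) by exact: valid_iter_path_min.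
have vY i : valid (Y i) by exact: valid_iter_path_min.
have XY i : pt (X i) = pt (Y i) by exact: path_point_iter_min.
have W0 : 0 < size (W j l) by apply: leq_ltn_trans (ltn_size_subst_iter sP j l).
have tK i : t i * Q %/ size (W j l) < K.+1.
  rewrite ltnS /K mulnAC; apply: (@leq_trans (max_size s ^ 2 * size (W j l) * Q %/ size (W j l))).
    apply: leq_div2r; rewrite leq_mul2r; apply/orP; right.
    have := path_pos_lt j.+1 (vX i); have := path_pos_lt j.+1 (vY i).
    have := leq_size_subst_iterS j (lev (X i) j.+1) l.
    have := leq_size_subst_iterS j (lev (Y i) j.+1) l.
    by rewrite /t; lia.
  by rewrite -mulnA (mulnC (size _)) mulnA mulnK // mulnAC.
have [i [i' [ii' fE]]] : exists i i' : 'I_J.+1, i < i' /\ f i = f i'.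
  have : ~~ injectiveb f.
    apply/negP => /injectiveP /leq_card; rewrite card_ord -/J; lia.
  case/injectivePn => i [i' ne fE].
  have [lt|lt|/val_inj E] := ltngtP i i'; [by exists i, i'|by exists i', i|].
  by rewrite E eqxx in ne.
have b1 : (pos (Y i) j.+1 <= pos (X i) j.+1) = (pos (Y i') j.+1 <= pos (X i') j.+1).
  exact: (congr1 (fun z : bool * A * A * 'I_K.+1 => z.1.1.1) fE).
have b2 : lev (X i) j.+1 = lev (X i') j.+1 by exact: (congr1 (fun z : bool * A * A * 'I_K.+1 =>
  z.1.1.2) fE).
have b3 : lev (Y i) j.+1 = lev (Y i') j.+1 by exact: (congr1 (fun z : bool * A * A * 'I_K.+1 =>
  z.1.2) fE).
have tt : t i = t i'.
  have : t i * Q %/ size (W j l) = t i' * Q %/ size (W j l).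
    rewrite -(inordK (tK i)) -(inordK (tK i'));
      exact: (congr1 (fun z : bool * A * A * 'I_K.+1 => val z.2) fE).
  rewrite /t; case: leqP b1 => le /esym; case: leqP => // le' _ b4.
    exact: overlap_bucket.
  by apply: (overlap_bucket (vY i) (vX i) _ (vY i') (vX i')) => //; exact: ltnW.
apply: (@overlap_determines_depth x y e (i * e.+1) (i' * e.+1) j.+1) => //.
- by apply: (@leq_trans (i.+1 * e.+1)); [rewrite mulSn; lia | rewrite leq_mul2r ii' orbT].
- by rewrite jE ltnW // ltnS leq_mul2r ltnW ?orbT.
- by move: tt b1; rewrite /t -/(X i) -/(Y i) -/(X i') -/(Y i'); lia.
Qed.

End Recognizability.

(** * Strong orbit equivalence *)

Section Dynamics.
Local Open Scope classical_set_scope.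

Definition agree (A : Type) N (x y : int -> A) := forall i : int, (`|i| <= N)%N -> x i = y i.

Lemma agree_le (A : Type) N M (x y : int -> A) : (M <= N)%N -> agree N x y -> agree M x y.
Proof. by move=> MN xy i iM; apply: xy; apply: leq_trans MN. Qed.

(** * Cylinder neighbourhoods and continuity on subshifts *)

Section Cylinders.
Variable A : finType.

Lemma nbhs_full_shift (x : full_shift A) U : nbhs x U ->
  exists N, forall y, agree N y x -> U y.
Proof.
pose F : set_system (full_shift A) := filter_from setT (fun N => [set y : full_shift A | agree N
  y x]).
have FF : Filter F.
  apply: filter_from_filter; first by exists 0.
  move=> M N _ _; exists (maxn M N) => // y xy; split.
    by apply: agree_le xy; exact: leq_maxl.
  by apply: agree_le xy; exact: leq_maxr.
suff Fx : F --> x by move=> /Fx [N _ NU]; exists N => y; exact: NU.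
apply/cvg_sup => i V [V' [[W oW <-] Wx] VV].
by exists `|i|%N => // y xy; apply: VV; rewrite /= xy.
Qed.

Lemma full_shift_agree (x : full_shift A) N : nbhs x [set y : full_shift A | agree N y x].
Proof.
have coord i : nbhs x [set y : full_shift A | y i = x i].
  apply: (@proj_continuous int (fun=> discrete_topology A) i x [set a | a = x i]).
  by rewrite nbhs_principalE.
elim: N => [|N IH].
  by apply: filterS (coord 0%R) => y /= xy i; rewrite leqn0 absz_eq0 => /eqP ->.
apply: filterS (filterI IH (filterI (coord (Posz N.+1)) (coord (- N.+1%:Z)%R))) => y /= [xy [y1
  y2]] i.
rewrite leq_eqVlt => /orP [/eqP iN|]; last by rewrite ltnS; exact: xy.
by have [->|->] : i = Posz N.+1 \/ i = (- N.+1%:Z)%R by lia.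
Qed.

Variables (s : A -> seq A).

Lemma subst_space_agree (x : subst_system s) N :
  nbhs x [set y : subst_system s | agree N (set_val y) (set_val x)].
Proof.
have c : continuous (set_val : subst_space s -> full_shift A) by exact: initial_continuous.
exact: (c x _ (full_shift_agree (set_val x) N)).
Qed.

Lemma nbhs_subst_space (x : subst_system s) U : nbhs x U ->
  exists N, forall y : subst_system s, agree N (set_val y) (set_val x) -> U y.
Proof.
move=> [V [[W oW <-] Wx] VU].
have [N NW] := nbhs_full_shift (open_nbhs_nbhs (conj oW Wx)).
by exists N => y xy; apply: VU; exact: NW.
Qed.

Lemma discrete_continuous_at (T : choiceType) (f : subst_system s -> T) x :
  (exists N, forall y : subst_system s, agree N (set_val y) (set_val x) -> f y = f x) ->
  {for x, continuous (f : subst_system s -> discrete_topology T)}.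
Proof.
move=> [N NE] U; rewrite nbhs_principalE => /principal_filterP Ux.
by apply: filterS (subst_space_agree x N) => y /NE /= ->.
Qed.

Lemma subst_system_continuous (B : finType) (t : B -> seq B) (f : subst_system s ->
  subst_system t) :
  (forall x i, exists N, forall y : subst_system s, agree N (set_val y) (set_val x) ->
    set_val (f y) i = set_val (f x) i) -> continuous f.
Proof.
move=> H; apply: continuous_comp_initial.
apply: (@prod_continuous _ int (fun=> discrete_topology B)) => i x.
exact: (@discrete_continuous_at B (fun y => set_val (f y) i) x (H x i)).
Qed.

End Cylinders.

(** * Compactness of subshifts and sliding block codes *)

Section Compact.
Variables (A : finType) (s : A -> seq A).

Lemma subst_system_continuous_local (B : finType) (t : B -> seq B)
    (f : subst_system s -> subst_system t) : continuous f ->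
  forall x i, exists N, forall y : subst_system s, agree N (set_val y) (set_val x) ->
    set_val (f y) i = set_val (f x) i.
Proof.
move=> cf x i; apply: nbhs_subst_space.
apply: (cf x [set z | set_val z i = set_val (f x) i]).
by apply: filterS (subst_space_agree (f x) `|i|) => z /= ->.
Qed.

Lemma subst_system_ext (x y : subst_system s) : (forall i, set_val x i = set_val y i) -> x = y.
Proof. by move=> xy; apply/val_inj/funext. Qed.

Lemma subst_system_compact (x : nat -> subst_system s) :
  exists z : subst_system s, forall n M, exists2 N,
    (M <= N)%N & agree n (set_val (x N)) (set_val z).
Proof.
(* Recording the coordinates [i] and [-i] together turns two-sided sequences into one-sided ones. *)
have [|z zP] := @konig _ (enum {: A * A}) (fun N i => (set_val (x N) (Posz i),
  set_val (x N) (- i%:Z)%R)).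
  by move=> N i; rewrite mem_enum.
pose w (i : int) : A := if (0 <= i)%R then (z `|i|%N).1 else (z `|i|%N).2.
have wP n M : exists2 N, (M <= N)%N & agree n (set_val (x N)) w.
  have [N MN xz] := zP n.+1 M; exists N => // i lt; rewrite /w -xz //.
  by case: ifP => i0 /=; congr (set_val _ _); lia.
have ws : w \in (subst_space s : set (full_shift A)).
  apply/mem_set => i k; have [N _ xw] := wP (`|i| + k)%N 0.
  suff -> : subword w i k = subword (set_val (x N)) i k by exact: (set_valP (x N)).
  apply/eq_in_map => j; rewrite mem_iota => jk; rewrite xw //; lia.
by exists (exist _ w ws).
Qed.

(** This is the Curtis-Hedlund-Lyndon argument: without a common radius, pairs of points violating
    larger and larger radii accumulate at a point where [f] is not continuous. *)
Lemma subst_system_uniform (B : finType) (t : B -> seq B)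
    (f : subst_system s -> subst_system t) : continuous f ->
  exists N, forall x y : subst_system s, agree N (set_val x) (set_val y) ->
    set_val (f x) 0%R = set_val (f y) 0%R.
Proof.
move=> cf; apply: contrapT => no.
have /choice [xy xyP] : forall N, exists xy : subst_system s * subst_system s,
    agree N (set_val xy.1) (set_val xy.2) /\ set_val (f xy.1) 0%R <> set_val (f xy.2) 0%R.
  move=> N; apply: contrapT => ne; apply: no; exists N => x y xy; apply: contrapT => xyf.
  by apply: ne; exists (x, y).
have [z zP] := subst_system_compact (fun N => (xy N).1).
have [n nP] := subst_system_continuous_local cf z 0%R.
have [N nN xz] := zP n n; have [ag] := xyP N; apply.
rewrite (nP _ xz) (nP (xy N).2) // => i lt.
by rewrite -ag ?xz // (leq_trans lt).
Qed.

End Compact.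

Lemma set_val_zpow (A : finType) (s : A -> seq A) (n : int) (z : subst_system s) i :
  set_val (zpow n z) i = set_val z (i + n)%R.
Proof.
have pos k (x : subst_system s) j : set_val (iter k dmap x) j = set_val x (j + k%:Z)%R.
  elim: k j => [|k IH] j; first by rewrite addr0.
  by rewrite iterS -[LHS]/(set_val (iter k dmap x) (j + 1)%R) IH; congr (set_val _ _); lia.
have neg k (x : subst_system s) j : set_val (iter k dinv x) j = set_val x (j - k%:Z)%R.
  elim: k j => [|k IH] j; first by rewrite subr0.
  by rewrite iterS -[LHS]/(set_val (iter k dinv x) (j + (-1))%R) IH; congr (set_val _ _); lia.
by case: n => k; [rewrite pos | rewrite neg NegzE].
Qed.

Lemma zpowD (A : finType) (s : A -> seq A) (n m : int) (z : subst_system s) :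
  zpow n (zpow m z) = zpow (n + m)%R z.
Proof. by apply: subst_system_ext => i; rewrite !set_val_zpow addrA. Qed.

(** * The shift as the Vershik map on paths *)

Section Vershik.
Variables (A : finType) (s : A -> seq A) (l r : A).
Hypothesis sP : proper_subst s l r.

Notation I n := (iter n (subst_word s)).
Notation W := (subst_iter s).
Notation valid := (valid_path s l).
Notation pt := (path_point s l r).
Notation lev := (path_letter s l).
Notation pos := (path_pos s).

Definition max_path (n : nat) : A * nat := (r, (size (s r)).-1).
Definition min_path (n : nat) : A * nat := (l, 0).

Lemma valid_max_path : valid max_path.
Proof.
have lt : (size (s r)).-1 < size (s r) by have := proper_size sP r; lia.
by case=> [|n]; split=> //=; rewrite (proper_last sP).
Qed.

Lemma valid_min_path : valid min_path.
Proof.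
have lt : 0 < size (s l) by have := proper_size sP l; lia.
by case=> [|n]; split=> //=; rewrite (proper_head sP).
Qed.

Lemma max_path_letter n : lev max_path n = r.
Proof. by case: n => //=; rewrite (proper_last sP). Qed.

Lemma min_path_letter n : lev min_path n = l.
Proof. by case: n => //=; rewrite (proper_head sP). Qed.

Lemma min_path_pos n : pos min_path n = 0.
Proof. by elim: n => //= n ->; rewrite take0 iter_subst_nil. Qed.

Lemma max_path_pos n : (pos max_path n).+1 = size (W n r).
Proof.
elim: n => // n IH.
have := path_split n valid_max_path; rewrite !max_path_letter => /= E.
rewrite -addnS IH [subst_word _ _]E !size_cat drop_oversize ?iter_subst_nil ?addn0 //.
by have := proper_size sP r; lia.
Qed.

(** Both windows contain [W n r] followed by [W n l]; the maximal path points to the last letter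
    before this boundary, the minimal path to the first one after it. *)
Lemma path_point_max (i : int) : pt max_path (i + 1)%R = pt min_path i.
Proof.
have nth_catD (u v : seq A) k : nth l (u ++ v) (size u + k) = nth l v k.
  by rewrite nth_cat ltnNge leq_addr /= addKn.
have [n lin] : exists n, `|i| < n by exists `|i|.+1.
have nr := ltn_size_subst_iter sP n r; have nl := ltn_size_subst_iter sP n l.
have mp := max_path_pos n; have mp1 := max_path_pos n.+1.
have [i0|i0] : (0 <= i)%R \/ (i < 0)%R by lia.
  have li : `|i|%N < size (W n (lev min_path n)) by rewrite min_path_letter; lia.
  have := path_pointW sP valid_min_path li.
  rewrite min_path_pos min_path_letter subr0 => H.
  have -> : i = Posz `|i|%N by lia.
  rewrite H; have lt : size (W n r) + size (W n.+1 r) + `|i| < size (path_window s l r max_path n).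
    by rewrite /path_window max_path_letter !size_cat; lia.
  have := path_pointE sP valid_max_path lt; rewrite /path_window max_path_letter.
  rewrite -addnA !nth_catD => <-.
  by congr pt; rewrite /path_base; lia.
have li : size (W n r) - `|i| < size (W n (lev max_path n)) by rewrite max_path_letter; lia.
have := path_pointW sP valid_max_path li; rewrite max_path_letter.
have -> : ((size (W n r) - `|i|)%N%:Z - (pos max_path n)%:Z = i + 1)%R by lia.
move=> ->.
have lt : size (W n r) - `|i| < size (path_window s l r min_path n).
  by rewrite /path_window !size_cat; lia.
have := path_pointE sP valid_min_path lt; rewrite /path_window nth_cat ifT; last by lia.
move=> <-; congr pt; rewrite /path_base min_path_pos; lia.
Qed.

Lemma eq_max_path x : valid x -> (forall n, ~~ ((pos x n).+1 < size (W n (lev x n)))) ->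
  x = max_path.
Proof.
move=> vx H.
have pE n : (pos x n).+1 = size (W n (lev x n)).
  by have := path_pos_lt n vx; have := H n; lia.
have kE n : (x n).2.+1 = size (s (x n).1).
  have [lt _] := vx n; have := pE n.+1; rewrite (path_split n vx) /= !size_cat.
  rewrite -addnS pE => E; have : size (I n (drop (x n).2.+1 (s (x n).1))) = 0 by lia.
  case D: (drop _ _) => [|b w].
    by have := size_drop (x n).2.+1 (s (x n).1); rewrite D /=; lia.
  by rewrite iter_subst_cons size_cat; have := ltn_size_subst_iter sP n b; lia.
have levE n : lev x n = r by have [_ <-] := vx n; rewrite -(proper_last sP (x n).1) -kE.
apply/funext => n; have := levE n.+1; have := kE n; rewrite /max_path /=.
by case: (x n) => a k /= + ar; rewrite ar => <-.
Qed.

Hypothesis inj : forall x y, valid x -> valid y -> pt x = pt y -> x = y.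

(** The path with the next position in the same block of level [n] codes the shifted point, so it is
    [y] by injectivity of the coding. *)
Lemma path_successor x y n : valid x -> valid y -> (forall i, pt y i = pt x (i + 1)%R) ->
  (pos x n).+1 < size (W n (lev x n)) ->
  (forall m, n <= m -> y m = x m) /\ pos y n = (pos x n).+1.
Proof.
move=> vx vy yx lt.
have [||m _|z [vz zx zp]] := @path_splice A s l n (pos x n).+1 x.
- by have [_ ->] := vx n.
- by have [] := vx n.
- exact: (vx m.+1).
suff -> : y = z by [].
apply: inj => //; apply/funext => i; rewrite yx.
rewrite (@path_point_tail _ s l r sP x z n) //; last by move=> m nm; rewrite zx.
by congr pt; rewrite zp; lia.
Qed.

End Vershik.

(** * Transport of points along a map of edges *)

Section Half.
Variables (A : finType) (s t : A -> seq A) (l r : A) (phi : A -> nat -> nat).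
Hypotheses (sP : proper_subst s l r) (tP : proper_subst t l r).
Hypothesis s_inj : forall x y, valid_path s l x -> valid_path s l y ->
  path_point s l r x = path_point s l r y -> x = y.

Definition map_path (x : nat -> A * nat) n := ((x n).1, phi (x n).1 (x n).2).

Hypothesis phiP : forall a k, k < size (s a) ->
  phi a k < size (t a) /\ nth l (t a) (phi a k) = nth l (s a) k.
Hypothesis phi_first : forall a, phi a 0 = 0.
Hypothesis phi_last : forall a, phi a (size (s a)).-1 = (size (t a)).-1.

Lemma map_path_letter x n : valid_path s l x ->
  path_letter t l (map_path x) n = path_letter s l x n.
Proof. by move=> vx; case: n => //=; have [lt _] := vx 0; have [_ ->] := phiP lt. Qed.

Lemma valid_map_path x : valid_path s l x -> valid_path t l (map_path x).
Proof.
move=> vx n; rewrite map_path_letter //; have [lt <-] := vx n.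
exact: phiP.
Qed.

Lemma orbit_map : exists H : subst_system s -> subst_system t,
  [/\ continuous H,
    forall x z, valid_path s l x -> path_point s l r x = set_val z ->
      set_val (H z) = path_point t l r (map_path x) &
    exists2 n : subst_system s -> int, forall z, H (dmap z) = zpow (n z) (H z) &
      at_most_one_discontinuity n].
Proof.
have /choice [adr adrP] : forall z : subst_system s, exists x,
    valid_path s l x /\ path_point s l r x = set_val z.
  by move=> z; have [x vx xz] := path_point_surj sP (set_valP z); exists x.
have va z : valid_path s l (adr z) by have [] := adrP z.
have ptE z : path_point s l r (adr z) = set_val z by have [] := adrP z.
have /choice [H HE] : forall z : subst_system s, exists w : subst_system t,
    set_val w = path_point t l r (map_path (adr z)).
  move=> z; have ws : path_point t l r (map_path (adr z)) \in (subst_space t : set (full_shift A)).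
    by apply/mem_set => i k; exact: (language_path_point tP _ _ (valid_map_path (va z))).
  by exists (exist (fun x => x \in subst_space t) _ ws).
have local z n : exists N, forall z' : subst_system s, agree N (set_val z') (set_val z) ->
    forall m, m < n -> adr z' m = adr z m.
  have [N NP] := path_local (fun y vy => @s_inj y (adr z) vy (va z)) n.
  exists N => z' zz'; apply: NP => // i iN; rewrite !ptE; exact: zz'.
(* Under [P z N] the shifted point stays in the same block of level [N]. The value of the cocycle is
   then [D z N], the difference of the two transported positions in the corresponding block of
   [t]. *)
pose P z N := (path_pos s (adr z) N).+1 < size (subst_iter s N (path_letter s l (adr z) N)).
pose D z N := ((path_pos t (map_path (adr (dmap z))) N)%:Z - (path_pos t (map_path (adr z))
  N)%:Z)%R.
have suc z N : P z N -> (forall m, N <= m -> adr (dmap z) m = adr z m) /\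
    path_pos s (adr (dmap z)) N = (path_pos s (adr z) N).+1.
  move=> PzN; apply: (path_successor sP s_inj) => // i.
  by rewrite !ptE.
have DE z N M : P z N -> P z M -> D z N = D z M.
  wlog NM : N M / N <= M.
    by move=> wh PN PM; have [/wh ->|/ltnW /wh ->] := leqP N M.
  move=> /suc [PN _] _; rewrite /D; apply/esym/path_pos_tail => // k Nk.
  by rewrite /map_path PN.
(* The value 1 belongs to the maximal path: it is transported to the maximal path and its successor
   to the minimal one. *)
have /choice [n nP] : forall z, exists j : int,
    (exists2 N, P z N & j = D z N) \/ ((forall N, ~~ P z N) /\ j = 1%R).
  move=> z; have [[N PN]|no] := pselect (exists N, P z N); first by exists (D z N); left; exists N.
  exists 1%R; right; split=> // N; apply/negP => PN; apply: no; by exists N.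
exists H; split.
- apply: subst_system_continuous => z i; have [N NP] := local z `|i|.+1.
  exists N => z' /NP zz'; rewrite !HE; apply: path_point_local => m lt.
  by rewrite /map_path zz'.
- move=> x z vx xz; rewrite HE; congr (path_point _ _ _ (map_path _)).
  by apply: s_inj => //; rewrite ptE.
exists n.
  move=> z; apply: subst_system_ext => i; rewrite set_val_zpow !HE.
  have [[N PN ->]|[noP ->]] := nP z.
    have [tailE _] := suc z N PN.
    apply: (path_point_tail tP i (valid_map_path (va z)) (valid_map_path (va (dmap z)))).
    by move=> m Nm; rewrite /map_path tailE.
  have maxE : adr z = max_path s r by exact: (eq_max_path sP).
  have minE : adr (dmap z) = min_path l.
    apply: s_inj => //; first exact: valid_min_path sP.
    by apply/funext => j; rewrite -path_point_max // -maxE !ptE.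
  have -> : map_path (adr z) = max_path t r by rewrite maxE; apply/funext => m;
    rewrite /map_path /= phi_last.
  have -> : map_path (adr (dmap z)) = min_path l by rewrite minE; apply/funext => m;
    rewrite /map_path /= phi_first.
  by rewrite path_point_max.
(* The cocycle at [z] is computed from the first [N.+1] edges, which are constant near [z]. *)
have cont z N : P z N -> {for z, continuous (n : subst_system s -> discrete_topology int)}.
  move=> PN; apply: discrete_continuous_at.
  have [M MP] := local z N.+1; exists M => z' /MP zz'.
  have posE : path_pos s (adr z') N = path_pos s (adr z) N.
    by apply: path_pos_local => m mN; rewrite zz' // ltnW.
  have levE : path_letter s l (adr z') N = path_letter s l (adr z) N.
    by have [_ <-] := va z' N; have [_ <-] := va z N; rewrite zz'.
  have PN' : P z' N by rewrite /P posE levE.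
  have nE w : P w N -> n w = D w N.
    by move=> Pw; have [[K PK ->]|[/(_ N)]] := nP w; [exact: DE | rewrite Pw].
  rewrite !nE // /D; have [t1 p1] := suc z N PN; have [t2 p2] := suc z' N PN'.
  have adrE m : m < N -> adr (dmap z') m = adr (dmap z) m.
    apply: (@path_pos_inj _ s l) => //; last by rewrite p1 p2 posE.
    have [_ <-] := va (dmap z') N; have [_ <-] := va (dmap z) N.
    by rewrite t1 // t2 // zz'.
  congr (_%:Z - _%:Z)%R; apply: path_pos_local => m mN; rewrite /map_path ?adrE //.
  by rewrite zz' // ltnW.
have discP z : ~ {for z, continuous (n : subst_system s -> discrete_topology int)} ->
    adr z = max_path s r.
  move=> nc; apply: (eq_max_path sP) => // N; apply/negP => PN; apply: nc; exact: cont PN.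
move=> z z' /discP az /discP az'; apply: subst_system_ext => i.
by rewrite -!ptE az az'.
Qed.

End Half.

(** [phi] and [psi] give transport maps inverse to each other. The second cocycle is that of the
    inverse map, evaluated at [H x]. *)
Theorem matching_strong_orbit_equivalent (A : finType) (s t : A -> seq A) (l r : A)
    (phi psi : A -> nat -> nat) :
  proper_subst s l r -> proper_subst t l r ->
  (forall x y, valid_path s l x -> valid_path s l y ->
    path_point s l r x = path_point s l r y -> x = y) ->
  (forall x y, valid_path t l x -> valid_path t l y ->
    path_point t l r x = path_point t l r y -> x = y) ->
  (forall a k, k < size (s a) ->
    phi a k < size (t a) /\ nth l (t a) (phi a k) = nth l (s a) k) ->
  (forall a k, k < size (t a) ->
    psi a k < size (s a) /\ nth l (s a) (psi a k) = nth l (t a) k) ->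
  (forall a, phi a 0 = 0) -> (forall a, psi a 0 = 0) ->
  (forall a, phi a (size (s a)).-1 = (size (t a)).-1) ->
  (forall a, psi a (size (t a)).-1 = (size (s a)).-1) ->
  (forall a k, k < size (s a) -> psi a (phi a k) = k) ->
  (forall a k, k < size (t a) -> phi a (psi a k) = k) ->
  strong_orbit_equivalent (subst_system s) (subst_system t).
Proof.
move=> sP tP si ti phiP psiP phi0 psi0 phil psil phiK psiK.
have [H [cH HE [n nP nd]]] := orbit_map sP tP si phiP phi0 phil.
have [G [cG GE [m mP md]]] := orbit_map tP sP ti psiP psi0 psil.
have HK : cancel H G.
  move=> z; apply: subst_system_ext => i; have [x vx xz] := path_point_surj sP (set_valP z).
  rewrite (GE _ _ (valid_map_path phiP vx) (esym (HE _ _ vx xz))) -[set_val z]xz;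
    congr (path_point _ _ _ _ _); apply/funext => k; rewrite /map_path /= phiK.
    by case: (x k).
  by have [] := vx k.
have GK : cancel G H.
  move=> z; apply: subst_system_ext => i; have [x vx xz] := path_point_surj tP (set_valP z).
  rewrite (HE _ _ (valid_map_path psiP vx) (esym (GE _ _ vx xz))) -[set_val z]xz;
    congr (path_point _ _ _ _ _); apply/funext => k; rewrite /map_path /= psiK.
    by case: (x k).
  by have [] := vx k.
(* A cocycle for one step yields values for all powers, so orbits go into orbits. *)
have orb (B C : finType) (u : B -> seq B) (v : C -> seq C) (F : subst_system u ->
  subst_system v) k :
    (forall z, F (dmap z) = zpow (k z) (F z)) -> forall i z, exists j, F (zpow i z) = zpow j (F z).
  move=> Fk i z.
  have up p : exists j, F (iter p dmap z) = zpow j (F z).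
    elim: p => [|p [j IH]]; first by exists 0%R.
    by exists (k (iter p dmap z) + j)%R; rewrite iterS Fk IH zpowD.
  have dn p : exists j, F (iter p dinv z) = zpow j (F z).
    elim: p => [|p [j IH]]; first by exists 0%R.
    exists (- k (iter p.+1 dinv z) + j)%R; rewrite -zpowD -IH.
    have {1}-> : iter p dinv z = dmap (iter p.+1 dinv z) by rewrite iterS dinvK.
    by rewrite Fk zpowD addNr.
  by case: i => p; [exact: up | exact: dn].
exists H; split.
  split; first by exists G.
  move=> z; apply/seteqP; split=> [w [w' [i _ <-] <-]|w [i _ <-]].
    by have [j ->] := orb _ _ _ _ H n nP i z; exists j.
  have [j E] := orb _ _ _ _ G m mP i (H z).
  exists (zpow j z); first by exists j.
  by rewrite -[RHS]GK E HK.
exists n, (m \o H); split=> //.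
- by move=> z; rewrite -[dmap (H z)]GK mP HK.
- move=> x y /= dx dy; apply: (can_inj HK); apply: md => c; [apply: dx|apply: dy];
  exact: (continuous_comp (cH _) c).
Qed.

Lemma perm_eq_matching (T : eqType) (x0 : T) (u v : seq T) : perm_eq u v ->
  exists f g : nat -> nat,
    (forall k, k < size u -> [/\ f k < size v, nth x0 v (f k) = nth x0 u k & g (f k) = k]) /\
    (forall k, k < size v -> [/\ g k < size u, nth x0 u (g k) = nth x0 v k & f (g k) = k]).
Proof.
rewrite perm_sym => /(perm_iotaP x0) [p pu vE].
have sp : size p = size u by rewrite (perm_size pu) size_iota.
have mp k : (k \in p) = (k < size u) by rewrite (perm_mem pu) mem_iota.
exists (index^~ p), (nth 0 p); split=> k; rewrite vE ?size_map => lk.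
  have kp : k \in p by rewrite mp.
  by split; rewrite ?index_mem ?(nth_map 0) ?nth_index ?index_mem.
have kp : nth 0 p k \in p by rewrite mem_nth.
split; [by rewrite -mp | by rewrite (nth_map 0) | ].
by rewrite index_uniq // (perm_uniq pu) iota_uniq.
Qed.

Lemma strong_orbit_equivalent_perm (A : finType) (s t : A -> seq A) (l r : A) :
  proper_subst s l r -> (forall a, exists u v, [/\ s a = l :: rcons u r,
    t a = l :: rcons v r & perm_eq u v]) ->
  aperiodic s l -> aperiodic t l ->
  strong_orbit_equivalent (subst_system s) (subst_system t).
Proof.
move=> sP st sap tap.
have tP : proper_subst t l r.
  move=> a; have [u [v [sE tE uv]]] := st a; exists v; split=> // b.
  have [w [sE' wP]] := sP a; rewrite -(perm_mem uv).
  by move: sE'; rewrite sE => -[/rcons_inj [->]]; exact: wP.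
have [Qs QsP] := bounded_powers sP sap; have [Qt QtP] := bounded_powers tP tap.
have /choice [p pP] : forall a, exists p : (nat -> nat) * (nat -> nat),
    [/\ [/\ p.1 0 = 0, p.2 0 = 0, p.1 (size (s a)).-1 = (size (t a)).-1 &
      p.2 (size (t a)).-1 = (size (s a)).-1],
    (forall k, k < size (s a) ->
      [/\ p.1 k < size (t a), nth l (t a) (p.1 k) = nth l (s a) k & p.2 (p.1 k) = k]) &
    (forall k, k < size (t a) ->
      [/\ p.2 k < size (s a), nth l (s a) (p.2 k) = nth l (t a) k & p.1 (p.2 k) = k])].
  move=> a; have [u [v [sE tE uv]]] := st a.
  have [f [g [fP gP]]] := perm_eq_matching l uv; have uvs := perm_size uv.
  (* [F h] fixes the first and the last index and applies [h] to the interior, whose indices are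
     shifted by one. *)
  pose F (h : nat -> nat) k := if k == 0 then 0 else
    if k == (size u).+1 then k else (h k.-1).+1.
  have key (w w' : seq A) h h' : size w = size u -> size w' = size u ->
      (forall k, k < size w -> [/\ h k < size w', nth l w' (h k) = nth l w k & h' (h k) = k]) ->
      forall k, k < size (l :: rcons w r) -> [/\ F h k < size (l :: rcons w' r),
        nth l (l :: rcons w' r) (F h k) = nth l (l :: rcons w r) k & F h' (F h k) = k].
    move=> sw sw' hP k; rewrite /= !size_rcons sw sw' !ltnS /F.
    case: k => [|k] //=; rewrite eqSS ltnS leq_eqVlt => /orP [/eqP ->|lk].
      by rewrite eqxx /= eqxx !nth_rcons sw sw' ltnn eqxx.
    rewrite ltn_eqF //=; have [] := hP k; rewrite ?sw ?sw' // => h1 h2 h3.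
    by rewrite eqSS (ltn_eqF h1) h3 !nth_rcons sw sw' h1 lk h2 ltnS ltnW.
  exists (F f, F g); rewrite sE tE; split.
  - by rewrite /F /= !size_rcons -uvs !eqxx.
  - by apply: key => //; exact/esym.
  - by apply: key => //; exact/esym.
apply: (@matching_strong_orbit_equivalent _ s t l r (fun a => (p a).1) (fun a => (p a).2)) => //.
- exact: path_point_inj sP _ QsP.
- exact: path_point_inj tP _ QtP.
- by move=> a k lk; have [_ /(_ k lk) []] := pP a.
- by move=> a k lk; have [_ _ /(_ k lk) []] := pP a.
- by move=> a; have [[]] := pP a.
- by move=> a; have [[]] := pP a.
- by move=> a; have [[]] := pP a.
- by move=> a; have [[]] := pP a.
- by move=> a k lk; have [_ /(_ k lk) []] := pP a.
- by move=> a k lk; have [_ _ /(_ k lk) []] := pP a.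
Qed.

Lemma homeomorphism_comp (X Y Z : topologicalType) (f : X -> Y) (g : Y -> Z) :
  homeomorphism f -> homeomorphism g -> homeomorphism (g \o f).
Proof.
move=> [f' [fK f'K cf cf']] [g' [gK g'K cg cg']]; exists (f' \o g'); split.
- exact: can_comp.
- exact: can_comp.
- by move=> x; apply: continuous_comp; [exact: cf|exact: cg].
- by move=> x; apply: continuous_comp; [exact: cg'|exact: cf'].
Qed.

Lemma homeomorphism_sym (X Y : topologicalType) (f : X -> Y) : homeomorphism f ->
  exists g : Y -> X, homeomorphism g.
Proof. by move=> [g [fK gK cf cg]]; exists g, f. Qed.

Lemma strong_orbit_equivalent_cantor (X Y : dynsys) :
  strong_orbit_equivalent X Y -> cantor_set Y -> cantor_set X.
Proof.
move=> [h [[hh _] _]] [c hc]; have [g hg] := homeomorphism_sym hh.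
by exists (g \o c); apply: homeomorphism_comp.
Qed.

(** * Subshifts with the same language *)

Section SameLanguage.
Variables (A : finType) (s t : A -> seq A).
Hypothesis st : forall w, language s w <-> language t w.

Lemma subst_system_same_language : exists2 h : subst_system s -> subst_system t,
  homeomorphism h & forall z n, h (zpow n z) = zpow n (h z).
Proof.
have HE (u v : A -> seq A) : (forall w, language u w -> language v w) ->
    exists h : subst_system u -> subst_system v, forall z, set_val (h z) = set_val z.
  move=> uv; have /choice [h hE] : forall z : subst_system u,
      exists w : subst_system v, set_val w = set_val z.
    move=> z; have zv : set_val z \in (subst_space v : set (full_shift A)).
      by apply/mem_set => i k; apply: uv; exact: (set_valP z).
    by exists (exist (fun x => x \in subst_space v) _ zv).
  by exists h.
have [h hE] := HE s t (fun w => (st w).1); have [g gE] := HE t s (fun w => (st w).2).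
exists h; last first.
  by move=> z n; apply: subst_system_ext => i; rewrite set_val_zpow !hE set_val_zpow.
exists g; split.
- by move=> z; apply: subst_system_ext => i; rewrite gE hE.
- by move=> z; apply: subst_system_ext => i; rewrite hE gE.
- by apply: subst_system_continuous => z i; exists `|i|%N => y yz; rewrite !hE yz.
- by apply: subst_system_continuous => z i; exists `|i|%N => y yz; rewrite !gE yz.
Qed.

Lemma strong_orbit_equivalent_same_language (X : dynsys) :
  strong_orbit_equivalent X (subst_system s) -> strong_orbit_equivalent X (subst_system t).
Proof.
move=> [h [[hh horb] [n [m [nP mP nd md]]]]].
have [g hg gE] := subst_system_same_language.
exists (g \o h); split; first split.
- exact: homeomorphism_comp.
- move=> x; have -> : dorbit ((g \o h) x) = g @` dorbit (h x).
    apply/seteqP; split=> [_ [i _ <-]|_ [_ [i _ <-] <-]].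
      by exists (zpow i (h x)); [exists i | rewrite gE].
    by exists i => //; rewrite -gE.
  by rewrite -horb image_comp.
- exists n, m; split=> // x; first by rewrite /= nP gE.
  by rewrite /= mP -[dmap (h x)]/(zpow 1 (h x)) gE.
Qed.

End SameLanguage.

(** * Aperiodicity, and exponents under isomorphism *)

Lemma cantor_inhabited (A : finType) (s : A -> seq A) :
  cantor_set (subst_system s) -> inhabited A.
Proof. by move=> [h _]; exists; exact: (set_val (h (fun=> true)) (Posz 0)). Qed.

(** If [d] were a period of the language, [d] coordinates would determine a point and the space
    would be finite. *)
Lemma cantor_aperiodic (A : finType) (s : A -> seq A) (l : A) :
  cantor_set (subst_system s) -> aperiodic s l.
Proof.
move=> [h [g [hK _ _ _]]] d d0; apply: contrapT => no.
have per (z : subst_system s) i : set_val z (i + d%:Z)%R = set_val z i.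
  apply: contrapT => ne; apply: no; exists (subword (set_val z) i d.+1); first exact: (set_valP z).
  split; first by rewrite size_map size_iota.
  rewrite !(nth_map 0) ?size_iota ?nth_iota // ?add0n addr0.
  by apply/eqP => E; apply: ne.
have perM (z : subst_system s) i k : set_val z (i + (k * d)%N%:Z)%R = set_val z i.
  elim: k => [|k IH]; first by rewrite mul0n addr0.
  by rewrite -[RHS]IH -[RHS]per; congr (set_val _ _); lia.
have perN i : exists2 j, j < d & forall z : subst_system s, set_val z i = set_val z (Posz j).
  exists (`|(i + (`|i| * d)%N%:Z)%R| %% d)%N; first by rewrite ltn_mod.
  move=> z; rewrite -(perM z i `|i|%N) -(perM z (Posz (_ %% _)) (`|(i + (`|i| * d)%N%:Z)%R| %/
    d)%N).
  congr (set_val _ _); have := divn_eq `|(i + (`|i| * d)%N%:Z)%R|%N d; nia.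
pose f (x : cantor_space) : {ffun 'I_d -> A} := [ffun j : 'I_d => set_val (h x) (Posz j)].
have f_inj x y : f x = f y -> h x = h y.
  move=> /ffunP xy; apply: subst_system_ext => i; have [j jd jE] := perN i.
  by rewrite !jE; have := xy (Ordinal jd); rewrite !ffunE.
(* These are distinct points of the Cantor space, one more than there are words of length [d]. *)
pose e (n : 'I_#|{ffun 'I_d -> A}|.+1) : cantor_space := fun m => m == n.
have /leq_card : injective (f \o e).
  move=> m n /f_inj /(can_inj hK) /(congr1 (fun x : cantor_space => x m)).
  by rewrite /e eqxx => /esym/eqP/val_inj.
by rewrite card_ord ltnn.
Qed.

(** A sliding block code of radius [N] keeps the period and shortens a word by [N + N] letters. For
    large [d] this is less than [d], so the exponent drops by at most one. *)
Lemma isomorphic_powers (A B : finType) (s : A -> seq A) (t : B -> seq B) (l r : A) (b : B) g :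
  proper_subst s l r -> isomorphic (subst_system s) (subst_system t) ->
  (forall N, exists d v, [/\ N <= d, language s v, has_period l d v & g * d <= size v]) ->
  forall N, exists d v, [/\ N <= d, language t v, has_period b d v & g.-1 * d <= size v].
Proof.
move=> sP [f [f' [_ _ cf _]] fT] Hs M.
have [N NP] := subst_system_uniform cf.
have [d [v [Nd Lv vper vs]]] := Hs (M + N + N).+1.
have [g0|g0] := posnP g.
  exists d, [::]; split; [by lia| |by []|by rewrite g0].
  by exists 0, b; exact: prefixW (prefix0s _).
have v0 : 0 < size v by apply: leq_trans vs; rewrite muln_gt0 g0; lia.
have [x vx xE] := word_in_path_point sP Lv v0.
have xs : path_point s l r x \in subst_space s.
  by apply/mem_set => i k; exact: language_path_point.
pose z : subst_system s := exist (fun x => x \in subst_space s) _ xs.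
have zE (j : nat) : j < size v -> set_val z (Posz j) = nth l v j.
  by move=> jv; rewrite -xE // subr0.
have fz (i : nat) : set_val (f z) (Posz i) = set_val (f (zpow (Posz i) z)) 0%R.
  have -> : f (zpow (Posz i) z) = zpow (Posz i) (f z).
    by elim: i => // i IH; rewrite -[zpow (Posz i.+1) z]/(dmap (zpow (Posz i) z)) fT IH.
  by rewrite set_val_zpow add0r.
have dN : N + N < d by lia.
have gd : g * d = g.-1 * d + d by case: g g0 {Hs vs} => // g _; rewrite mulSn addnC.
exists d, (subword (set_val (f z)) N%:Z%R (size v - (N + N))); split.
- by lia.
- exact: (set_valP (f z)).
- move=> i; rewrite size_map size_iota => lt.
  rewrite !(nth_map 0) ?size_iota ?nth_iota //; try lia.
  rewrite !add0n -!PoszD !fz; apply: NP => k kN.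
  rewrite !set_val_zpow.
  have -> : (k + Posz (N + i))%R = Posz `|(k + Posz (N + i))%R|%N by lia.
  have -> : (k + Posz (N + (i + d)))%R = Posz (`|(k + Posz (N + i))%R| + d)%N by lia.
  by rewrite !zE; [apply: vper; lia | lia | lia].
- by rewrite size_map size_iota; lia.
Qed.

End Dynamics.

(** * Rearranged powers of a substitution *)

(** As [a] occurs in all its iterated images from level [p] on, the words of level [n] reappear at
    all levels from [n + p] on, in particular at a multiple of [k]. *)
Lemma language_of_power (A : finType) (s : A -> seq A) k v : 0 < k ->
  (forall a, s a != [::]) -> primitive_subst s ->
  language (subst_iter s k) v <-> language s v.
Proof.
move=> k0 s0 [p pP].
have powE n a : subst_iter (subst_iter s k) n a = subst_iter s (n * k) a.
  have wE w : subst_word (subst_iter s k) w = iter k (subst_word s) w.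
    elim: w => [|b w IH]; first by rewrite iter_subst_nil.
    by rewrite iter_subst_cons -IH.
  elim: n => // n IH; rewrite mulSn subst_iterD -IH -wE.
  by rewrite /subst_iter iterS.
split=> [[n [a va]]|[n [a va]]]; first by exists (n * k), a; rewrite -powE.
have mem m : a \in subst_iter s (p + m) a.
  rewrite subst_iterD; have : subst_iter s m a != [::].
    elim: m => // m; rewrite -add1n subst_iterD; case: (subst_iter s m a) => // b w _.
    by rewrite iter_subst_cons subst_iter1; case: (s b) (s0 b).
  case: (subst_iter s m a) => // b w _.
  by rewrite iter_subst_cons mem_cat pP.
exists (n + p), a; rewrite powE; apply: infix_trans va _.
have -> : (n + p) * k = n + (p + ((n + p) * k - (n + p))).
  by have : n + p <= (n + p) * k; [rewrite leq_pmulr | lia].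
by rewrite subst_iterD; apply: mem_infix_iter_subst.
Qed.

(** After [p] steps every letter has become at least two letters, so the lower bound for the counts
    doubles. *)
Lemma primitive_count (A : finType) (s : A -> seq A) N : 1 < #|A| ->
  (forall a, s a != [::]) -> primitive_subst s ->
  exists k, forall m a b, k <= m -> N <= count_mem b (subst_iter s m a).
Proof.
move=> A2 s0 [p pP].
have W0 m a : subst_iter s m a != [::].
  elim: m a => // m IH a; rewrite subst_iterS; case: (s a) (s0 a) => // b w _.
  by rewrite iter_subst_cons; case: (subst_iter s m b) (IH b).
suff [k kP] : exists k, forall m a b, k <= m -> 2 ^ N <= count_mem b (subst_iter s m a).
  by exists k => m a b km; apply: leq_trans (kP m a b km); rewrite ltnW // ltn_expl.
elim: N => [|N [k kP]].
  exists p => m a b pm; rewrite -has_count has_pred1 -(subnKC pm) subst_iterD.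
  case: (subst_iter s (m - p) a) (W0 (m - p) a) => // c w _.
  by rewrite iter_subst_cons mem_cat pP.
have sz a : 1 < size (subst_iter s p a).
  have [c [d [_ _ cd]]] := card_gt1P A2.
  have := pP a c; have := pP a d; case: (subst_iter s p a) => [|c' [|d' w]] //=.
  by rewrite !inE => /eqP dE /eqP cE; rewrite cE dE eqxx in cd.
exists (p + k) => m a b km; have pm : p <= m by apply: leq_trans km; exact: leq_addr.
rewrite -(subnK pm) subst_iterD expnS.
apply: (@leq_trans (size (subst_iter s p a) * 2 ^ N)); first by rewrite leq_mul2r sz orbT.
elim: (subst_iter s p a) => [|c w IH]; first by rewrite iter_subst_nil.
by rewrite iter_subst_cons count_cat mulSn leq_add // kP //; lia.
Qed.

(** Every orbit of [f] meets a periodic point within [#|A|] steps; as all periodic points coincide,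
    there is only one and it is fixed. *)
Lemma iter_eventually_constant (A : finType) (f : A -> A) (a0 : A) :
  (forall c d m n, iter m.+1 f c = c -> iter n.+1 f d = d -> c = d) ->
  exists p c, forall k a, p <= k -> iter k f a = c.
Proof.
move=> uniq_per.
have hit a : exists2 i, i <= #|A| & exists m, iter m.+1 f (iter i f a) = iter i f a.
  have : ~~ injectiveb (fun i : 'I_#|A|.+1 => iter i f a).
    by apply/negP => /injectiveP /leq_card; rewrite card_ord ltnn.
  case/injectivePn => i [j ij].
  wlog lt : i j ij / i < j.
    move=> wh E; have [lt|lt|/val_inj ijE] := ltngtP i j; first exact: (wh i j).
      by apply: (wh j i) => //; rewrite eq_sym.
    by rewrite ijE eqxx in ij.
  move=> E; exists i; first by rewrite -ltnS ltn_ord.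
  by exists (j - i).-1; rewrite -iterD prednK ?subn_gt0 // subnK // ltnW.
have [i0 _ [m0 E0]] := hit a0; exists #|A|, (iter i0 f a0) => k a Ak.
set c := iter i0 f a0 in E0 *.
have fc : f c = c by apply: (uniq_per _ _ m0 m0) => //; rewrite -iterSr iterS E0.
have [i iA [m E]] := hit a; have Ec : iter i f a = c by apply: uniq_per E E0.
have ik : i <= k by exact: leq_trans Ak.
rewrite -(subnK ik) iterD Ec; elim: (k - i) => //= n ->; exact: fc.
Qed.

(** * First and last letters of iterated images *)

Section Letters.
Variables (A : finType) (s : A -> seq A).
Hypothesis s0 : forall a, s a != [::].

Lemma subst_iter_last k a : exists w,
  subst_iter s k a = rcons w (iter k (fun c => last c (s c)) a).
Proof.
elim: k => [|k [w IH]]; first by exists [::].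
rewrite iterS; set c := iter k _ a in IH *.
rewrite -add1n subst_iterD IH iter_subst_rcons subst_iter1.
case/lastP: (s c) (s0 c) => // u b _; rewrite last_rcons.
by exists (iter 1 (subst_word s) w ++ u); rewrite rcons_cat.
Qed.

Lemma subst_iter_head k a : exists w,
  subst_iter s k a = iter k (fun c => head c (s c)) a :: w.
Proof.
elim: k => [|k [w IH]]; first by exists [::].
rewrite iterS; set c := iter k _ a in IH *.
rewrite -add1n subst_iterD IH iter_subst_cons subst_iter1.
case: (s c) (s0 c) => // b u _.
by exists (u ++ iter 1 (subst_word s) w).
Qed.

End Letters.

(** * Prefix codes obtained by permuting interiors *)

Section Rearrangement.
Variables (A : finType) (l r y : A).
Hypothesis ly : l != y.

(** The letters [l] form one run, the source of high powers. It also marks the end of the initial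
    run of [y], whose length [i.+1] can thus be recognized. *)
Definition arrange i (w : seq A) := nseq i.+1 y ++ nseq (count_mem l w) l ++
  nseq (count_mem y w - i.+1) y ++ seq.filter (predC (pred2 l y)) w.

Lemma perm_arrange i w : i < count_mem y w -> perm_eq w (arrange i w).
Proof.
move=> iw; apply/allP => x _; apply/eqP; rewrite /arrange !count_cat !count_nseq count_filter /=.
have no z : (z \in [:: l; y]) -> count (predI (pred1 z) (predC (pred2 l y))) w = 0.
  move=> zly; rewrite (@eq_count _ _ pred0) ?count_pred0 // => z' /=.
  by case: eqP => //= ->; move: zly; rewrite !inE => ->.
have [xl|xl] := boolP (x == l).
  move/eqP: xl => ->; rewrite eqxx eq_sym (negPf ly) no ?inE ?eqxx //.
  by rewrite !mul0n !add0n mul1n addn0.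
have [xy|xy] := boolP (x == y).
  move/eqP: xy => ->; rewrite eqxx (negPf ly) no ?inE ?eqxx ?orbT //.
  by rewrite !mul1n !mul0n add0n addn0 subnKC.
rewrite eq_sym (negPf xy) [l == x]eq_sym (negPf xl) !mul0n !add0n.
by apply: eq_count => z /=; case: eqP => //= ->; rewrite (negPf xl) (negPf xy).
Qed.

Variable t : A -> seq A.

Definition word_interior (u : seq A) := behead (take (size u).-1 u).

Lemma word_interiorE a w b : word_interior (a :: rcons w b) = w.
Proof. by rewrite /word_interior [size _]/= size_rcons /= -cats1 take_size_cat. Qed.

(* The length of the first run of [y] in the image of [a] encodes [a]. *)
Definition rearrange a := l :: rcons (arrange (enum_rank a) (word_interior (t a))) r.

Hypothesis tP : forall a, exists w, [/\ t a = l :: rcons w r,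
  #|A| <= count_mem y w & 0 < count_mem l w].

Lemma rearrange_perm a : exists u v, [/\ t a = l :: rcons u r,
  rearrange a = l :: rcons v r & perm_eq u v].
Proof.
have [w [tE wy wl]] := tP a; exists w, (arrange (enum_rank a) w).
rewrite /rearrange {2}tE word_interiorE; split=> //; apply: perm_arrange.
exact: leq_trans (ltn_ord _) wy.
Qed.

(** Right after the shorter of the two initial runs of [y], one word has [l] and the other still has
    [y]. *)
Lemma rearrange_code a b u v : rearrange a ++ u = rearrange b ++ v -> a = b.
Proof.
suff key c d u' v' : enum_rank c < enum_rank d -> rearrange c ++ u' = rearrange d ++ v' -> False.
  move=> E; have [lt|lt|/val_inj/enum_rank_inj //] := ltngtP (enum_rank a) (enum_rank b).
    by case: (key _ _ _ _ lt E).
  by case: (key _ _ _ _ lt (esym E)).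
move=> lt /(congr1 (nth l ^~ (enum_rank c).+2)).
have [w [tE _ wl]] := tP c; have [w' [tE' _ _]] := tP d.
rewrite /rearrange tE tE' !word_interiorE /arrange -!cats1 /= -!catA.
rewrite nth_cat size_nseq ltnn subnn nth_cat size_nseq wl nth_nseq wl.
rewrite nth_cat size_nseq lt nth_nseq lt => E.
by move: ly; rewrite E eqxx.
Qed.

Lemma rearrange_injective : injective (subst_word rearrange).
Proof.
elim=> [|a u IH] [|b v] //.
rewrite -[subst_word _ (a :: u)]/(rearrange a ++ subst_word rearrange u).
rewrite -[subst_word _ (b :: v)]/(rearrange b ++ subst_word rearrange v) => E;
  have ab : a = b by apply: rearrange_code E.
by subst b; move/eqP: E; rewrite eqseq_cat // eqxx => /eqP /IH ->.
Qed.

Lemma rearrange_run a g : (forall w, t a = l :: rcons w r -> g <= count_mem l w) ->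
  infix (nseq g l) (rearrange a).
Proof.
move=> ga; have [w [tE _ _]] := tP a; have {ga} gw := ga w tE.
rewrite /rearrange tE word_interiorE /arrange -(subnKC gw) nseqD -!cats1 -!catA -cat1s catA.
exact: infix_infix.
Qed.

End Rearrangement.

(** Removing the first or the last block of a power leaves the same word. *)
Lemma has_period_power (A : finType) (s : A -> seq A) (a b : A) n g :
  has_period b (size (subst_iter s n a)) (iter n (subst_word s) (nseq g a)).
Proof.
case: g => [|g] i; first by rewrite iter_subst_nil.
have E1 : iter n (subst_word s) (nseq g.+1 a) =
    subst_iter s n a ++ iter n (subst_word s) (nseq g a) by rewrite iter_subst_cons.
have E2 : iter n (subst_word s) (nseq g.+1 a) =
    iter n (subst_word s) (nseq g a) ++ subst_iter s n a.
  by rewrite -addn1 nseqD cats1 iter_subst_rcons.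
rewrite {1}E1 size_cat addnC ltn_add2l => lt; rewrite {1}E2 E1.
by rewrite !nth_cat lt ltnNge leq_addr /= addKn.
Qed.

Lemma size_iter_subst_nseq (A : finType) (s : A -> seq A) (a : A) n g :
  size (iter n (subst_word s) (nseq g a)) = g * size (subst_iter s n a).
Proof.
by elim: g => [|g IH]; rewrite ?iter_subst_nil // iter_subst_cons size_cat IH.
Qed.

Lemma isomorphic_sym (X Y : dynsys) : isomorphic X Y -> isomorphic Y X.
Proof.
move=> [h [g [hK gK ch cg]] hT]; exists g; first by exists h.
by move=> y; apply: (can_inj hK); rewrite gK hT gK.
Qed.

(** * Pairwise non-isomorphic rearrangements *)

Section Family.
Variables (A : finType) (s : A -> seq A) (l r : A).
Hypothesis s0 : forall a, s a != [::].
Hypothesis s_prim : primitive_subst s.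
Hypothesis s_ends : exists p, forall k a, p <= k ->
  (exists w, subst_iter s k a = l :: w) /\ (exists w, subst_iter s k a = rcons w r).
Hypothesis s_cantor : cantor_set (subst_system s).

Lemma rearranged_power g m : exists k (z : A -> seq A),
  [/\ m < k, forall a, perm_eq (subst_iter s k a) (z a),
    proper_subst z l r /\ aperiodic z l,
    strong_orbit_equivalent (subst_system z) (subst_system s) &
    forall N, exists d v, [/\ N <= d, language z v, has_period l d v & g * d <= size v]].
Proof.
have ap : aperiodic s l by exact: cantor_aperiodic.
have [u _ [su une]] := ap 1 isT.
have A2 : 1 < #|A| by apply/card_gt1P; exists (nth l u 0), (nth l u 1).
have [y ly] : exists y, l != y.
  have [c [d [_ _ cd]]] := card_gt1P A2.
  by have [<-|] := eqVneq c l; [exists d | exists c; rewrite eq_sym].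
have [p pP] := s_ends.
(* The interior needs [#|A|] letters [y] for the code and [g] letters [l] for the run; the two end
   letters are not part of it. *)
have [q qP] := primitive_count (#|A| + g + 3) A2 s0 s_prim.
(* The three summands make [k] exceed [m], fix the end letters and provide the letter counts. *)
pose k := m.+1 + p + q; pose t := subst_iter s k.
have tE a : exists w, t a = l :: rcons w r /\ forall b, #|A| + g < count_mem b w.
  have [[w1 E1] [w2 E2]] := pP k a ltac:(rewrite /k; lia).
  have tc b : #|A| + g + 3 <= count_mem b (t a) by apply: qP; rewrite /k; lia.
  case/lastP: w1 E1 => [|w b] E1; first by have := tc l; rewrite /t E1 /= eqxx; lia.
  have br : b = r by move: E1; rewrite E2 -rcons_cons => /rcons_inj [].
  exists w; rewrite /t E1 br; split=> // c; have := tc c.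
  by rewrite /t E1 /= -cats1 count_cat /=; case: (_ == _); case: (_ == _); lia.
have tP : proper_subst t l r.
  move=> a; have [w [E wP]] := tE a; exists w; split=> // b.
  by rewrite -has_pred1 has_count (leq_ltn_trans _ (wP b)).
have tc a : exists w, [/\ t a = l :: rcons w r, #|A| <= count_mem y w & 0 < count_mem l w].
  have [w [E wP]] := tE a; exists w; split=> //; [have := wP y | have := wP l]; lia.
pose z := rearrange l r y t.
have zP : proper_subst z l r.
  move=> a; have [w [v [tw zv wv]]] := rearrange_perm ly tc a; exists v; split=> // b.
  have [w' [tw' w'P]] := tP a; rewrite -(perm_mem wv).
  by move: tw'; rewrite tw => -[/rcons_inj [->]]; exact: w'P.
have lang v : language t v <-> language s v by apply: language_of_power; rewrite // /k; lia.
have tap : aperiodic t l.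
  by move=> d d0; have [v Lv vP] := ap d d0; exists v => //; apply/lang.
have zap : aperiodic z l by apply: aperiodic_of_injective zP _ A2 (rearrange_injective ly tc).
exists k, z; split=> //.
- by rewrite /k; lia.
- move=> a; have [w [v [tw zv wv]]] := rearrange_perm ly tc a.
  by rewrite -/(t a) tw [z a]zv perm_cons -!cats1 perm_cat2r.
- apply: (strong_orbit_equivalent_same_language lang).
  apply: (@strong_orbit_equivalent_perm _ z t l r) => // a.
  have [w [v [tw zv wv]]] := rearrange_perm ly tc a.
  by exists v, w; rewrite perm_sym.
move=> N; exists (size (subst_iter z N l)), (iter N (subst_word z) (nseq g l)); split.
- exact: ltnW (ltn_size_subst_iter zP N l).
- apply: language_iter; exists 1, l; rewrite subst_iter1.
  apply: rearrange_run => // w tw; have [w' [tw' /(_ l)]] := tE l.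
  by move: tw; rewrite tw' => -[/rcons_inj [->]]; lia.
- exact: has_period_power.
- by rewrite size_iter_subst_nseq.
Qed.

Lemma rearranged_family : exists (k : nat -> nat) (z : nat -> A -> seq A),
  [/\ forall n, 0 < k n, injective k,
    forall n, (forall a, perm_eq (subst_iter s (k n) a) (z n a)) /\ proper_subst (z n) l r,
    forall n, strong_orbit_equivalent (subst_system (z n)) (subst_system s) &
    forall n m, n <> m -> ~ isomorphic (subst_system (z n)) (subst_system (z m))].
Proof.
(* [F M] consists of a power above [M], a rearrangement whose language has exponent [M.+1] for
   arbitrarily long periods, and a number above both this power and all exponents in that
   language. *)
have /choice [F FP] : forall M, exists kzM : nat * (A -> seq A) * nat,
    [/\ M < kzM.1.1 < kzM.2,
      (forall a, perm_eq (subst_iter s kzM.1.1 a) (kzM.1.2 a)) /\ proper_subst kzM.1.2 l r,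
      strong_orbit_equivalent (subst_system kzM.1.2) (subst_system s),
      forall N, exists d v, [/\ N <= d, language kzM.1.2 v, has_period l d v & M.+1 * d <= size v] &
      forall v d, language kzM.1.2 v -> 0 < d -> has_period l d v -> size v < kzM.2 * d].
  move=> M; have [k [z [Mk kz [zP zap] soe pow]]] := rearranged_power M.+1 M.
  have [Q QP] := bounded_powers zP zap.
  exists (k, z, maxn k.+1 Q); split=> //=.
    by rewrite Mk leq_max ltnSn.
  move=> v d Lv d0 vd; apply: leq_trans (QP v d Lv d0 vd) _.
  by rewrite leq_mul2r leq_maxr orbT.
(* The bound obtained for one system is the input for the next, so powers and exponents grow past
   all earlier bounds. *)
pose M n := iter n (fun M => (F M).2) 0.
have MS n : M n < (F (M n)).1.1 < M n.+1 by have [] := FP (M n).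
have Mle n m : n <= m -> M n <= M m.
  move=> /subnK <-; elim: (m - n) => // i IH; rewrite addSn.
  by apply: leq_trans IH _; have /andP [/ltnW + /ltnW] := MS (i + n); exact: leq_trans.
have Mlt n m : n < m -> (F (M n)).1.1 < (F (M m)).1.1.
  move=> /Mle nm; have /andP [_ lt1] := MS n; have /andP [lt2 _] := MS m.
  by apply: leq_trans lt1 (leq_trans nm (ltnW lt2)).
exists (fun n => (F (M n)).1.1), (fun n => (F (M n)).1.2); split.
- by move=> n; have /andP [lt _] := MS n; exact: leq_ltn_trans lt.
- by move=> n m E; have [/Mlt|/Mlt|//] := ltngtP n m; rewrite E ltnn.
- by move=> n; have [] := FP (M n).
- by move=> n; have [] := FP (M n).
have key n m : n < m -> ~ isomorphic (subst_system (F (M m)).1.2) (subst_system (F (M n)).1.2).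
  move=> nm iso; have [_ [_ mP] _ mpow _] := FP (M m); have [_ _ _ _ nbound] := FP (M n).
  (* The exponent left after the isomorphism is [M m], at least the bound [M n.+1] for system [n];
     the argument 1 makes [d] positive. *)
  have [d [v [d0 Lv vd vs]]] := isomorphic_powers l mP iso mpow 1.
  have := nbound v d Lv d0 vd; rewrite ltnNge => /negP; apply.
  by apply: leq_trans vs; rewrite leq_mul2r (Mle _ _ nm) orbT.
move=> n m nm; have [lt|lt|//] := ltngtP n m; last exact: key.
by move=> /isomorphic_sym; exact: key.
Qed.

End Family.

(** * Bratteli diagrams *)

(** This serves to list edges so that their sources spell a given word. *)
Lemma perm_map_lift (T U : eqType) (f : T -> U) (u : seq T) (v : seq U) :
  perm_eq (map f u) v -> exists2 w, perm_eq u w & map f w = v.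
Proof.
case: u => [|x0 u'].
  by rewrite perm_sym => /perm_nilP ->; exists [::].
set u := x0 :: u' => uv.
have [p pu vE] : exists2 p, perm_eq p (iota 0 (size (map f u))) & v = map (nth (f x0) (map f u)) p.
  by apply/perm_iotaP; rewrite perm_sym.
rewrite size_map in pu; exists (map (nth x0 u) p).
  rewrite perm_sym; apply/(perm_iotaP x0); by exists p.
rewrite vE -map_comp; apply/eq_in_map => i.
by rewrite (perm_mem pu) mem_iota => /andP [_ lt]; rewrite (nth_map x0).
Qed.

Lemma vertex0_eq (B : bratteli) (v w : vertex B 0) : v = w.
Proof. by have [x xP] := fintype1 (card_vertex0 B); rewrite (xP v) (xP w). Qed.

(** * Infinite paths of marked edges, which will be the maximal or the minimal ones *)

Section MarkedPaths.
Variables (B : bratteli) (A : finType) (lab : labelling B A).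
Variable M : forall n, edge B n -> Prop.
Hypothesis lab_bij : forall n, bijective (lab n).

(** All marked edges above the first level start at the letter [c], so a marked path passes through
    [c] at every level and its edges are forced. *)
Lemma marked_path_unique c :
  (forall n (e : edge B n.+1), M e -> src e = lab n c) ->
  (forall n (v : vertex B n.+1), exists e : edge B n, rng e = v /\ M e) ->
  (forall n (e f : edge B n), M e -> M f -> rng e = rng f -> e = f) ->
  exists! x : forall n, edge B n, is_path x /\ forall n, M (x n).
Proof.
move=> Msrc Mex Muniq.
pose x n := projT1 (cid (Mex n (lab n c))).
have xM n : M (x n) by have [_] := projT2 (cid (Mex n (lab n c))).
have xr n : rng (x n) = lab n c by have [] := projT2 (cid (Mex n (lab n c))).
exists x; split; first by split=> // n; rewrite xr (Msrc n).
move=> y [py My]; apply: functional_extensionality_dep => n.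
by apply: Muniq => //; rewrite xr py (Msrc n).
Qed.

(** [f] gives the label of the source of a marked edge. A periodic letter yields a marked path that
    runs through its cycle, so a unique path leaves one periodic letter. *)
Lemma marked_path_periodic (f : A -> A) :
  (forall v : vertex B 1, exists e : edge B 0, rng e = v /\ M e) ->
  (forall n a, exists e : edge B n.+1, [/\ rng e = lab n.+1 a, src e = lab n (f a) & M e]) ->
  (exists! x : forall n, edge B n, is_path x /\ forall n, M (x n)) ->
  forall c d m n, iter m.+1 f c = c -> iter n.+1 f d = d -> c = d.
Proof.
move=> M0 MS [z [_ zu]].
suff key c m : iter m.+1 f c = c -> rng (z 0) = lab 0 c.
  move=> c d m n /key zc /key zd; apply: (bij_inj (lab_bij 0)); by rewrite -zc.
(* On the cycle the [m]-th iterate inverts [f], so this runs through the cycle backwards. *)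
move=> fc; pose a n := iter (m * n) f c.
have aS n : f (a n.+1) = a n.
  by rewrite /a mulnS -iterS -addSn addnC iterD fc.
pose x n : edge B n := match n with
  | 0 => projT1 (cid (M0 (lab 0 (a 0))))
  | k.+1 => projT1 (cid (MS k (a k.+1)))
  end.
have xr n : rng (x n) = lab n (a n).
  case: n => [|n] /=; first by have [] := projT2 (cid (M0 (lab 0 (a 0)))).
  by have [] := projT2 (cid (MS n (a n.+1))).
have xs n : src (x n.+1) = lab n (a n).
  by have [_ -> _] := projT2 (cid (MS n (a n.+1))); rewrite aS.
have xM n : M (x n).
  case: n => [|n] /=; first by have [] := projT2 (cid (M0 (lab 0 (a 0)))).
  by have [] := projT2 (cid (MS n (a n.+1))).
rewrite (zu x) ?xr /a ?muln0 //.
by split=> // n; rewrite xr xs.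
Qed.

End MarkedPaths.

(** * Orders that realize a substitution with prescribed letter counts *)

Section Realize.
Variables (B : bratteli) (A : finType) (lab : labelling B A) (z : A -> seq A) (l r : A).
Hypothesis lab_bij : forall n, bijective (lab n).
Hypothesis B01 : no_multiple_edges01 B.
Hypothesis inc : forall n a b, incidence (lab n.+1 a) (lab n b) = count_mem b (z a).
Hypothesis zP : proper_subst z l r.

(** Equal counts allow a listing of the incoming edges whose sources spell [z a]; the order on these
    edges will be the one of this list. *)
Lemma incident_edges n a : exists u : seq (edge B n.+1),
  [/\ uniq u, u =i [pred e | rng e == lab n.+1 a] & map src u = map (lab n) (z a)].
Proof.
set E := [pred e : edge B n.+1 | rng e == lab n.+1 a].
have [|u Eu us] := @perm_map_lift _ _ (@src B n.+1) (enum E) (map (lab n) (z a)).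
  apply/allP => v _; apply/eqP; rewrite !count_map.
  have [b <-] : exists b, lab n b = v by have [g _ gK] := lab_bij n; exists (g v).
  have -> : count (preim (lab n) (pred1 (lab n b))) (z a) = count_mem b (z a).
    by apply: eq_count => c /=; rewrite (inj_eq (bij_inj (lab_bij n))).
  rewrite -(inc n a b) /incidence -sum1_card -sum1_count big_enum_cond /=.
  by apply: eq_bigl => e; rewrite !inE.
exists u; split=> //; first by rewrite -(perm_uniq Eu) enum_uniq.
by move=> e; rewrite -(perm_mem Eu) mem_enum.
Qed.

Let fan n a := projT1 (cid (incident_edges n a)).

Lemma fan_uniq n a : uniq (fan n a).
Proof. by have [] := projT2 (cid (incident_edges n a)). Qed.

Lemma mem_fan n a e : (e \in fan n a) = (rng e == lab n.+1 a).
Proof. by have [_ -> _] := projT2 (cid (incident_edges n a)). Qed.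

Lemma map_src_fan n a : map src (fan n a) = map (lab n) (z a).
Proof. by have [] := projT2 (cid (incident_edges n a)). Qed.

Lemma size_fan n a : size (fan n a) = size (z a).
Proof. by have := congr1 size (map_src_fan n a); rewrite !size_map. Qed.

Lemma lab_surj n v : exists a, lab n a = v.
Proof. by have [g _ gK] := lab_bij n; exists (g v). Qed.

Let label_of n v := projT1 (cid (@lab_surj n v)).

Lemma label_ofK n v : lab n (label_of v) = v.
Proof. exact: projT2 (cid (@lab_surj n v)). Qed.

Lemma labK n a : label_of (lab n a) = a.
Proof. by apply: (bij_inj (lab_bij n)); rewrite label_ofK. Qed.

Let edge_rank n (e : edge B n.+1) := index e (fan n (label_of (rng e))).

Lemma mem_fan_label n (e : edge B n.+1) : e \in fan n (label_of (rng e)).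
Proof. by rewrite mem_fan label_ofK. Qed.

Lemma edge_rank_lt n (e : edge B n.+1) : edge_rank e < size (z (label_of (rng e))).
Proof. by rewrite -(size_fan n) index_mem mem_fan_label. Qed.

Lemma edge_rank_inj n (e f : edge B n.+1) : rng e = rng f -> edge_rank e = edge_rank f -> e = f.
Proof.
move=> ef; rewrite /edge_rank ef => E.
by rewrite -(nth_index e (mem_fan_label f)) -E nth_index // -ef mem_fan_label.
Qed.

Lemma src_edge_rank n (e : edge B n.+1) : src e = lab n (nth l (z (label_of (rng e))) (edge_rank
  e)).
Proof.
rewrite -(nth_map _ (src e)) ?edge_rank_lt // -map_src_fan (nth_map e) ?nth_index //.
  exact: mem_fan_label.
by rewrite index_mem mem_fan_label.
Qed.

Lemma edge_at n a k : k < size (z a) -> exists2 e : edge B n.+1,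
  rng e = lab n.+1 a & edge_rank e = k.
Proof.
rewrite -(size_fan n) => lt; have [e0 _] := rng_surj (lab n.+1 a).
have : nth e0 (fan n a) k \in fan n a by rewrite mem_nth.
rewrite mem_fan => /eqP E; exists (nth e0 (fan n a) k) => //.
by rewrite /edge_rank E labK index_uniq ?fan_uniq.
Qed.

(** All comparisons hold in [edge B 0], where each vertex has a single incoming edge. *)
Definition rank_le : edge_rel B := fun n => match n return rel (edge B n) with
  | 0 => fun _ _ => true
  | m.+1 => fun e f => edge_rank e <= edge_rank f
  end.

Lemma edge0_eq (e f : edge B 0) : rng e = rng f -> e = f.
Proof. by apply: B01; exact: vertex0_eq. Qed.

Lemma rank_le_anti n (e f : edge B n) : rng e = rng f -> rank_le e f -> rank_le f e -> e = f.
Proof.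
case: n e f => [|n] e f; first by move=> /edge0_eq.
by move=> ef le1 le2; apply: edge_rank_inj => //; apply/eqP; rewrite eqn_leq; apply/andP.
Qed.

Lemma rank_le_order : is_order rank_le.
Proof.
move=> n v /=; split.
- by case: n v => [|n] v e _ //=.
- move=> e f; rewrite !inE => /eqP ev /eqP fv /andP [ef fe].
  by apply: rank_le_anti; rewrite ?ev ?fv.
- by case: n v => [|n] v e f g _ _ _ //=; exact: leq_trans.
- by case: n v => [|n] v e f _ _ //=; exact: leq_total.
Qed.

Lemma ordered_edges_rank n a : ordered_edges rank_le (lab n.+1 a) = fan n a.
Proof.
have In (u : seq (edge B n.+1)) : perm_eq u (fan n a) -> forall e, e \in u -> rng e = lab n.+1 a.
  by move=> uS e; rewrite (perm_mem uS) mem_fan => /eqP.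
have pE : perm_eq (ordered_edges rank_le (lab n.+1 a)) (fan n a).
  rewrite perm_sort; apply: uniq_perm; rewrite ?enum_uniq ?fan_uniq // => e.
  by rewrite mem_enum mem_fan.
apply: (@sorted_eq_in _ (@rank_le n.+1)) => //.
- by move=> e f g _ _ _ /=; exact: leq_trans.
- move=> e f /(In _ pE) er /(In _ pE) fr /andP [ef fe].
  by apply: rank_le_anti; rewrite ?er ?fr.
- by apply: sort_sorted => e f; exact: leq_total.
- have [e0 _] := rng_surj (lab n.+1 a); apply/(sortedP e0) => i lt.
  rewrite /= /edge_rank !(In _ (perm_refl _) _ (mem_nth e0 _)) ?labK ?index_uniq ?fan_uniq //.
  + exact: ltnW.
  + exact: ltnW.
Qed.

Lemma rank_le_reads : reads lab rank_le z.
Proof. by move=> n a; rewrite ordered_edges_rank map_src_fan. Qed.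

Lemma rank_le_stationary : stationary_ordered lab rank_le.
Proof.
split; first by split=> // n a b; rewrite !inc.
(* Edges of different levels are identified by the label of the range and the rank, which also
   determine the label of the source. *)
have transfer n m (e : edge B n.+1) : exists f : edge B m.+1,
    label_of (rng f) = label_of (rng e) /\ edge_rank f = edge_rank e.
  by have [f fr fi] := edge_at m (edge_rank_lt e); exists f; rewrite fr labK.
pose tr n m e := projT1 (cid (@transfer n m e)).
have trP n m e : label_of (rng (@tr n m e)) = label_of (rng e) /\ edge_rank (@tr n m e) =
  edge_rank e.
  exact: projT2 (cid (@transfer n m e)).
have trK n m e : @tr m n (@tr n m e) = e.
  have [r1 i1] := trP m n (@tr n m e); have [r2 i2] := trP n m e.
  by apply: edge_rank_inj; [rewrite -[LHS]label_ofK -[RHS]label_ofK r1 r2 | rewrite i1 i2].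
move=> n; exists (@tr 0 n); split.
- by exists (@tr n 0) => e; rewrite trK.
- move=> e a ea; have [E _] := trP 0 n e.
  by rewrite -[LHS]label_ofK E ea labK.
- move=> e a ea; have [E1 E2] := trP 0 n e.
  rewrite src_edge_rank E1 E2; congr lab; apply: (bij_inj (lab_bij 0)).
  by rewrite -ea -src_edge_rank.
- by move=> e f _ /=; have [_ ->] := trP 0 n e; have [_ ->] := trP 0 n f.
Qed.

(** As [z] is proper, the maximal edges above the first level start at the letter [r] and the
    minimal ones at [l]. *)
Lemma rank_le_proper : proper_order rank_le.
Proof.
split.
- apply: (@marked_path_unique _ _ lab (@max_edge B rank_le) r).
  + move=> n e maxe.
    have [|f fr fi] := @edge_at n (label_of (rng e)) (size (z (label_of (rng e)))).-1.
      by have := proper_size zP (label_of (rng e)); lia.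
    rewrite label_ofK in fr; have /= := maxe f fr; rewrite fi => le.
    rewrite src_edge_rank -(proper_last zP (label_of (rng e))); congr (lab _ (nth _ _ _)).
    by have := edge_rank_lt e; lia.
  + case=> [|n] v; first by have [e er] := rng_surj v; exists e.
    have [|f fr fi] := @edge_at n (label_of v) (size (z (label_of v))).-1.
      by have := proper_size zP (label_of v); lia.
    rewrite label_ofK in fr; exists f; split=> // g gr /=.
    by have := edge_rank_lt g; rewrite gr fr fi; lia.
  + by move=> n e f maxe maxf ef; apply: rank_le_anti => //; [exact: maxf | exact: maxe].
- apply: (@marked_path_unique _ _ lab (@min_edge B rank_le) l).
  + move=> n e mine.
    have [|f fr fi] := @edge_at n (label_of (rng e)) 0.
      by have := proper_size zP (label_of (rng e)); lia.
    rewrite label_ofK in fr; have /= := mine f fr; rewrite fi leqn0 => /eqP e0.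
    by rewrite src_edge_rank e0 (proper_head zP).
  + case=> [|n] v; first by have [e er] := rng_surj v; exists e.
    have [|f fr fi] := @edge_at n (label_of v) 0; first by have := proper_size zP (label_of v); lia.
    by rewrite label_ofK in fr; exists f; split=> // g gr /=; rewrite fi.
  + by move=> n e f mine minf ef; apply: rank_le_anti => //; [exact: mine | exact: minf].
Qed.

Lemma simple_of_incidence : simple_diagram B.
Proof.
case=> // n _; exists 1 => // v w.
have [b bv] := lab_surj v; have [a aw] := @lab_surj n.+1 w.
have : 0 < incidence (lab n.+1 a) (lab n b).
  by rewrite inc -has_count has_pred1 (proper_mem zP).
move=> /card_gt0P [e]; rewrite inE => /andP [/eqP er /eqP es].
pose p : Defs.fpath B n.+1 0 := v.
have pe : path_tgt (p, e).1 == src (p, e).2 by rewrite /= es bv.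
by exists (exist _ (p, e) pe); split=> //=; rewrite er aw.
Qed.

Lemma proper_order_of_incidence : exists le : edge_rel B,
  [/\ is_order le, proper_order le, stationary_ordered lab le & reads lab le z].
Proof.
by exists rank_le; split; [exact: rank_le_order | exact: rank_le_proper |
  exact: rank_le_stationary | exact: rank_le_reads].
Qed.

End Realize.

Lemma sum_count_mem (A : finType) (w : seq A) (F : A -> nat) :
  \sum_(c <- w) F c = \sum_c count_mem c w * F c.
Proof.
elim: w => [|a w IH]; first by rewrite big_nil big1.
rewrite big_cons IH /=; under [RHS]eq_bigr do rewrite mulnDl.
rewrite big_split /= [X in _ = X + _](bigD1 a) //= eqxx mul1n.
rewrite [X in _ = _ + X + _]big1 ?addn0 // => c ca.
by rewrite eq_sym (negPf ca).
Qed.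

(** * The substitution read on a diagram, and path counts *)

Section Reading.
Variables (B : bratteli) (le : edge_rel B) (A : finType) (lab : labelling B A)
  (s : A -> seq A).
Hypothesis B01 : no_multiple_edges01 B.
Hypothesis le_order : is_order le.
Hypothesis le_proper : proper_order le.
Hypothesis lab_bij : forall n, bijective (lab n).
Hypothesis s_reads : reads lab le s.

Lemma mem_ordered_edges n (v : vertex B n.+1) e : (e \in ordered_edges le v) = (rng e == v).
Proof. by rewrite mem_sort mem_enum. Qed.

Lemma reads_nonempty a : s a != [::].
Proof.
have [e er] := rng_surj (lab 1 a); apply/eqP => s0.
have /(congr1 size) := s_reads 0 a; rewrite s0 size_map.
have : e \in ordered_edges le (lab 1 a) by rewrite mem_ordered_edges er.
by case: (ordered_edges _ _).
Qed.

Lemma reads_incidence n a b : incidence (lab n.+1 a) (lab n b) = count_mem b (s a).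
Proof.
have -> : count_mem b (s a) = count_mem (lab n b) (map (lab n) (s a)).
  by rewrite count_map; apply: eq_count => c /=; rewrite (inj_eq (bij_inj (lab_bij n))).
rewrite s_reads count_map (permP (permEl (perm_sort _ _))) /incidence -sum1_card -sum1_count
  big_enum_cond /=.
by apply: eq_bigl => e; rewrite !inE.
Qed.

Lemma ordered_edges_sorted n (v : vertex B n.+1) : sorted (@le n) (ordered_edges le v).
Proof.
have [_ _ _ tot] := le_order v; apply: (sort_sorted_in tot).
by apply/allP => e; rewrite mem_enum.
Qed.

Lemma ordered_edges_le n (v : vertex B n.+1) e f : rng e = v -> rng f = v ->
  index e (ordered_edges le v) <= index f (ordered_edges le v) -> le e f.
Proof.
move=> ev fv; have [rf _ tr _] := le_order v.
have InP x : x \in ordered_edges le v -> rng x == v by rewrite mem_ordered_edges.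
apply: (sorted_leq_index_in _ _ (ordered_edges_sorted v)); rewrite ?mem_ordered_edges ?ev ?fv //.
- by move=> x y z /InP xv /InP yv /InP zv; apply: tr; rewrite inE.
- by move=> x /InP xv; apply: rf; rewrite inE.
Qed.

Lemma read_edge n a k : k < size (s a) -> exists e : edge B n.+1,
  [/\ rng e = lab n.+1 a, forall c, src e = lab n (nth c (s a) k) &
      index e (ordered_edges le (lab n.+1 a)) = k].
Proof.
have [e0 _] := rng_surj (lab n.+1 a).
have sz : size (s a) = size (ordered_edges le (lab n.+1 a)).
  by have /(congr1 size) := s_reads n a; rewrite !size_map.
move=> lt; have lt' := lt; rewrite sz in lt'.
have eS : nth e0 (ordered_edges le (lab n.+1 a)) k \in ordered_edges le (lab n.+1 a).
  by rewrite mem_nth.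
exists (nth e0 (ordered_edges le (lab n.+1 a)) k); split.
- by move: eS; rewrite mem_ordered_edges => /eqP.
- by move=> c; rewrite -(nth_map c (lab n c)) // s_reads (nth_map e0).
- by rewrite index_uniq // sort_uniq enum_uniq.
Qed.

Lemma extremal0 (v : vertex B 1) : exists e : edge B 0,
  rng e = v /\ max_edge le e /\ min_edge le e.
Proof.
have [e ev] := rng_surj v; exists e; split=> //.
have [rf _ _ _] := le_order v.
have ee : le e e by apply: rf; rewrite inE ev.
by split=> f fe; rewrite (B01 (vertex0_eq (src f) (src e)) fe).
Qed.

(** [last c (s c)] labels the source of the maximal edge into the vertex of [c], and its iterates
    give the last letters of the words [subst_iter s k a]. A unique maximal path leaves one periodic
    letter, where these iterates end up; first letters and minimal edges are treated alike. *)
Lemma subst_eventually_ends (a0 : A) : exists l r p, forall k a, p <= k ->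
  (exists w, subst_iter s k a = l :: w) /\ (exists w, subst_iter s k a = rcons w r).
Proof.
have [maxu minu] := le_proper.
have [|p [r rP]] := @iter_eventually_constant A (fun c => last c (s c)) a0.
  apply: (@marked_path_periodic B A lab (@max_edge B le) lab_bij _ _ _ maxu).
    by move=> v; have [e [ev [em _]]] := extremal0 v; exists e.
  move=> n a; have [|e [er es ei]] := @read_edge n a (size (s a)).-1.
    by rewrite prednK // lt0n size_eq0 reads_nonempty.
  exists e; split=> //; first by rewrite (es a) nth_last.
  move=> f fr; apply: (ordered_edges_le (etrans fr er) er); rewrite ei.
  have : f \in ordered_edges le (lab n.+1 a) by rewrite mem_ordered_edges fr er.
  have /(congr1 size) := s_reads n a; rewrite !size_map => ->.
  by rewrite -index_mem; case: (size _).
have [|q [l lP]] := @iter_eventually_constant A (fun c => head c (s c)) a0.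
  apply: (@marked_path_periodic B A lab (@min_edge B le) lab_bij _ _ _ minu).
    by move=> v; have [e [ev [_ em]]] := extremal0 v; exists e.
  move=> n a; have [|e [er es ei]] := @read_edge n a 0.
    by rewrite lt0n size_eq0 reads_nonempty.
  exists e; split=> //; first by rewrite (es a) nth0.
  by move=> f fr; apply: (ordered_edges_le er (etrans fr er)); rewrite ei.
exists l, r, (p + q) => k a pk; split.
  by have [w] := subst_iter_head reads_nonempty k a; rewrite lP; [exists w | lia].
by have [w] := subst_iter_last reads_nonempty k a; rewrite rP; [exists w | lia].
Qed.

(** Including level 0, with its only vertex as constant value, lets levels such as [k + i] be
    labelled without transport. *)
Definition level_label m : A -> vertex B m := match m return A -> vertex B m with
  | 0 => fun _ => projT1 (fintype1 (card_vertex0 B))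
  | n.+1 => lab n
  end.

Lemma level_label_bij m : 0 < m -> bijective (level_label m).
Proof. by case: m. Qed.

Lemma level_incidence m a b : 0 < m ->
  incidence (level_label m.+1 a) (level_label m b) = count_mem b (s a).
Proof. by case: m => // m _; exact: reads_incidence. Qed.

(** Path counts and letter counts of iterates both multiply like incidence matrices: a path of
    length [k.+1] is split at the source of its last edge, a word of level [k.+1] into the images of
    the letters of [s a]. *)
Lemma card_fpath i k a b : 0 < i ->
  #|[pred p : Defs.fpath B i k | (path_tgt p == level_label (k + i) a)
                               && (path_src p == level_label i b)]|
  = count_mem b (subst_iter s k a).
Proof.
move=> i0; elim: k a => [|k IH] a.
  rewrite /= addn0 -(inj_eq (bij_inj (level_label_bij i0))).
  have [ab|ab] := eqVneq (level_label i a) (level_label i b).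
    rewrite -[RHS](card1 (level_label i b)); apply: eq_card => v.
    by rewrite !inE -[level_label (0 + i) a]/(level_label i a) ab andbb.
  apply: eq_card0 => v; rewrite !inE; apply/negP => /andP [/eqP va /eqP vb].
  by case/eqP: ab; rewrite -[LHS]va -[RHS]vb.
have ki0 : 0 < k + i by rewrite addn_gt0 i0 orbT.
have [g gK Kg] := level_label_bij ki0.
pose P (pe : Defs.fpath B i k * edge B (k + i)) := path_tgt pe.1 == src pe.2.
pose R (pe : Defs.fpath B i k * edge B (k + i)) :=
  (rng pe.2 == level_label (k.+1 + i) a) && (path_src pe.1 == level_label i b).
transitivity #|[pred x : {x | P x} | R (val x)]|; first exact: eq_card.
transitivity #|[pred x | P x && R x]|.
  rewrite -(card_image val_inj); apply: eq_card => x; rewrite !inE.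
  apply/fintype.imageP/andP => [[y Ry ->]|[Px Rx]]; first by split; [exact: (valP y) | exact: Ry].
  by exists (exist _ x Px).
rewrite subst_iterS.
have -> : count_mem b (iter k (subst_word s) (s a)) = \sum_(c <- s a) count_mem b (subst_iter s k
  c).
  elim: (s a) => [|c w IHw]; first by rewrite iter_subst_nil big_nil.
  by rewrite iter_subst_cons count_cat IHw big_cons.
rewrite sum_count_mem -sum1_card.
rewrite (eq_bigl (fun x : Defs.fpath B i k * edge B (k + i) => (path_src x.1 == level_label i b) &&
    ((rng x.2 == level_label (k.+1 + i) a) && (src x.2 == path_tgt x.1)))); last first.
  by move=> x; rewrite !inE /P /R eq_sym; case: (_ == _); case: (_ == _); case: (_ == _).
rewrite -(@pair_big_dep _ _ _ _ _ (fun p : Defs.fpath B i k => path_src p == level_label i b)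
  (fun p (e : edge B (k + i)) => (rng e == level_label (k.+1 + i) a) && (src e == path_tgt p))
  (fun _ _ => 1)) /=.
(* The paths are grouped by the label of the vertex at which the last edge starts. *)
rewrite (partition_big (fun p : Defs.fpath B i k => g (path_tgt p)) predT) //=.
apply: eq_bigr => c _; rewrite -IH mulnC -sum_nat_const.
apply: eq_big => [p|p /andP [_ /eqP pc]].
  rewrite !inE andbC; congr (_ && _).
  by rewrite -{1}(gK c) (inj_eq (can_inj Kg)).
rewrite sum1_card -(@level_incidence (k + i) a c ki0) -pc Kg.
by apply: eq_card => e; rewrite !inE.
Qed.

End Reading.

(** * Telescoping with constant steps *)

Section Telescoping.
Variables (B : bratteli) (le : edge_rel B) (A : finType) (lab : labelling B A)
  (s : A -> seq A) (k : nat).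
Hypothesis k0 : 0 < k.

(** The first step 1 keeps the edges between levels 0 and 1 simple; the steps [k] produce the letter
    counts of [subst_iter s k]. *)
Definition increments i := if i is 0 then 1 else k.

Definition telescoped_label : labelling (telescoping B increments) A :=
  fun n => level_label lab (tlevel increments n.+1).

Lemma tlevel_gt0 n : 0 < tlevel increments n.+1.
Proof. by case: n => //= n; rewrite addn_gt0 k0. Qed.

Lemma telescoped_label_bij n : (forall n, bijective (lab n)) -> bijective (telescoped_label n).
Proof. by move=> lab_bij; apply: level_label_bij lab_bij _ _; exact: tlevel_gt0. Qed.

Lemma telescoped_no_multiple_edges01 : no_multiple_edges01 B ->
  no_multiple_edges01 (telescoping B increments).
Proof.
move=> B01 [[v e] ve] [[w f] wf] /= vw ef; apply: val_inj => /=.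
move: ve wf => /= /eqP ve /eqP wf; congr (_, _) => //.
by apply: B01 => //; rewrite -ve -wf.
Qed.

Lemma telescoped_incidence n a b : (forall n, bijective (lab n)) -> reads lab le s ->
  incidence (telescoped_label n.+1 a) (telescoped_label n b) = count_mem b (subst_iter s k a).
Proof.
move=> lab_bij s_reads.
exact: (card_fpath lab_bij s_reads k a b (tlevel_gt0 n)).
Qed.

End Telescoping.

(** * Assembling the family of telescopings *)

Theorem theorem3p1 (B : bratteli) (le : edge_rel B) (A : finType)
    (lab : labelling B A) (sigma : A -> seq A) :
  simple_diagram B ->
  no_multiple_edges01 B ->
  is_order le ->
  proper_order le ->
  stationary_ordered lab le ->
  reads lab le sigma ->
  primitive_subst sigma ->
  cantor_set (subst_system sigma) ->
  exists (d : nat -> nat -> nat)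
         (le' : forall n, edge_rel (telescoping B (d n)))
         (C : nat -> finType)
         (lab' : forall n, labelling (telescoping B (d n)) (C n))
         (zeta : forall n, C n -> seq (C n)),
    [/\ forall n,
          [/\ forall i, 0 < d n i,
              simple_diagram (telescoping B (d n)),
              no_multiple_edges01 (telescoping B (d n)),
              is_order (le' n) &
              proper_order (le' n)],
        forall n,
          [/\ stationary_ordered (lab' n) (le' n),
              reads (lab' n) (le' n) (zeta n),
              primitive_subst (zeta n) &
              cantor_set (subst_system (zeta n))],
        forall n n', n <> n' -> d n <> d n',
        forall n n', n <> n' ->
          ~ isomorphic (subst_system (zeta n)) (subst_system (zeta n')) &
        forall n,
          strong_orbit_equivalent (subst_system (zeta n))
                                  (subst_system sigma)].
Proof.
move=> _ B01 le_order le_proper [[lab_bij _] _] s_reads s_prim s_cantor.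
have [a0] := cantor_inhabited s_cantor.
have s0 := reads_nonempty s_reads.
have [l [r [p ends]]] := subst_eventually_ends B01 le_order le_proper lab_bij s_reads a0.
have [k [z [k0 k_inj zP soe noniso]]] :=
  rearranged_family s0 s_prim (ex_intro _ p ends) s_cantor.
pose d n := increments (k n); pose T n := telescoping B (d n).
pose lab' n : labelling (T n) A := telescoped_label lab (k n).
have lab'_bij n i : bijective (lab' n i) by exact: telescoped_label_bij.
have T01 n : no_multiple_edges01 (T n) by exact: telescoped_no_multiple_edges01.
have inc n i a b : incidence (lab' n i.+1 a) (lab' n i b) = count_mem b (z n a).
  have [/(_ a) /permP <- _] := zP n; exact: telescoped_incidence.
have /(_ _)/cid H n := proper_order_of_incidence (lab'_bij n) (T01 n) (inc n) (zP n).2.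
exists d, (fun n => projT1 (H n)), (fun=> A), lab', z; split=> //.
- move=> n; have [o1 o2 _ _] := projT2 (H n); split=> //.
  - by case=> [|i] //; exact: k0.
  - exact: simple_of_incidence (lab'_bij n) (inc n) (zP n).2.
  - exact: T01.
- move=> n; have [_ _ o3 o4] := projT2 (H n); split=> //.
    by exists 1 => a b; rewrite subst_iter1 (proper_mem (zP n).2).
  exact: strong_orbit_equivalent_cantor (soe n) s_cantor.
(* The increments of index 1 are the powers [k n], which are distinct. *)
- by move=> n m nm /(congr1 (fun f => f 1)) /k_inj.
Qed.
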